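(* Let $\mathbb F$ be a field of characteristic $0$. Let $\mathbbm r_1,\dots,\mathbbm r_\ell$ be noncommutative rational functions over $\mathbb F$ in $z_1,\dots,z_g$ and assume that the Sylvester degree of $\mathbbm r_j$ is at most $d$ and $\operatorname{dom}_m\mathbbm r_j\ne\emptyset$, for all $1\le j\le\ell$. If $\mathbbm r_1(\underline a),\dots,\mathbbm r_\ell(\underline a)$ are $\mathbb F$-linearly dependent for all $\underline a\in\bigcap_j\operatorname{dom}_N\mathbbm r_j$, where $$N=m\left\lceil\tfrac12\,m\,\ell!\,(3d+4)\right\rceil,$$ then $\mathbbm r_1,\dots,\mathbbm r_\ell$ are $\mathbb F$-linearly dependent.
   Context: Rational expressions and functions: $\mathcal R_{\mathbb F}(\underline z)$ is the set of syntactically valid combinations of noncommutative polynomials over $\mathbb F$ in $\underline z=\{z_1,\dots,z_g\}$, operations $+,\cdot,{}^{-1}$ and parentheses. For $\underline a\in M_m(\mathbb F)^g$, $r(\underline a)$ is obtained by replacing $z_j$ by $a_j$ and $1$ by $I_m$; $\operatorname{dom}_m r\subseteq M_m(\mathbb F)^g$ is the set of $\underline a$ at which all inverses occurring in $r$ exist; $\operatorname{dom}r=\bigcup_m\operatorname{dom}_mr$. $r$ is nondegenerate if $\operatorname{dom}r\ne\emptyset$. Nondegenerate $r_1,r_2$ are equivalent if they agree on $\operatorname{dom}r_1\cap\operatorname{dom}r_2$; noncommutative rational functions are the equivalence classes; they form a division ring containing $\mathbb F$ in its center. $\operatorname{dom}_m\mathbbm r$ is the union of $\operatorname{dom}_mr$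 over all representatives $r$ of $\mathbbm r$, and $\mathbbm r(\underline a)=r(\underline a)$ for any representative $r$ defined at $\underline a$; $\operatorname{dom}\mathbbm r=\bigcup_m\operatorname{dom}_m\mathbbm r$. Realizations: let $\mathcal A=M_m(\mathbb F)$, let $\underline x=\{x_1,\dots,x_g\}$ be freely noncommuting letters, $\mathcal A\langle\underline x\rangle=\mathcal A*_{\mathbb F}\mathbb F\langle\underline x\rangle$, with $(\underline x)$-adic completion $\mathcal A\langle\!\langle\underline x\rangle\!\rangle$. For a word $w=w_1\cdots w_k$, $\mathcal A^w$ is the $\mathbb F$-span of all $a_0w_1a_1\cdots w_ka_k$, $a_i\in\mathcal A$; every series is uniquely $S=\sum_w[S,w]$, $[S,w]\in\mathcal A^w$. For $\underline p\in\operatorname{dom}_m\mathbbm r$, a realization of $\mathbbm r$ of dimension $n$ about $\underline p$ is $(\mathbf c,A,\mathbf b)$ with $\mathbf c\in\mathcal A^{1\times n}$, $\mathbf b\in\mathcal A^{n\times1}$, $A^{x}\in(\mathcal A^{x})^{n\times n}$ such that the expansion $S=r(x_1+p_1,\dots,x_g+p_g)$ satisfies $[S,w]=\mathbf cA^w\mathbf b$ for all words $w$, where $A^w=A^{w_1}\cdots A^{w_{|w|}}$ and $r$ is any representative of $\mathbbm r$ defined at $\underline p$ (the expansion does not depend on $r$). The zero function has a realization of dimension $0$. The Sylvester degree of $\mathbbm r$ is the smallest dimension of a realization of $\mathbbm r$ about a point $\underline p\in\operatorname{dom}\mathbbm r$; it is independent of the choice of $\underline p$. *)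

(* Defs.v *)
From HB Require Import structures.
From mathcomp Require Import all_boot all_order all_algebra.
From mathcomp Require Import boolp.

Set Implicit Arguments.
Unset Strict Implicit.
Unset Printing Implicit Defensive.

Import GRing.Theory.
Local Open Scope ring_scope.

(** * Noncommutative formal power series *)

(* Series over [R] in noncommuting letters [L] that commute with [R]. *)
Definition ncps (R : pzRingType) (L : Type) := seq L -> R.

Section NcpsRing.
Variables (R : pzRingType) (L : Type).
Implicit Types S T U : ncps R L.

HB.instance Definition _ := Choice.copy (ncps R L) (seq L -> R).

Definition ncps_const (a : R) : ncps R L := fun u => if u is [::] then a else 0.
Definition ncps_opp S : ncps R L := fun u => - S u.
Definition ncps_add S T : ncps R L := fun u => S u + T u.
Definition ncps_mul S T : ncps R L :=
  fun u => \sum_(i < (size u).+1) S (take i u) * T (drop i u).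

Let shift (x : L) S : ncps R L := fun u => S (x :: u).

Fact ncps_mul_nil S T : ncps_mul S T [::] = S [::] * T [::].
Proof. by rewrite /ncps_mul big_ord1. Qed.

Fact ncps_mul_cons S T x u :
  ncps_mul S T (x :: u) = S [::] * T (x :: u) + ncps_mul (shift x S) T u.
Proof. by rewrite /ncps_mul big_ord_recl. Qed.

Fact ncps_addA : associative ncps_add.
Proof. by move=> S T U; apply/funext => u; rewrite /ncps_add addrA. Qed.

Fact ncps_addC : commutative ncps_add.
Proof. by move=> S T; apply/funext => u; rewrite /ncps_add addrC. Qed.

Fact ncps_add0 : left_id (ncps_const 0) ncps_add.
Proof. by move=> S; apply/funext => -[|x u]; rewrite /ncps_add /= add0r. Qed.

Fact ncps_addN : left_inverse (ncps_const 0) ncps_opp ncps_add.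
Proof. by move=> S; apply/funext => -[|x u]; rewrite /ncps_add /= addNr. Qed.

Fact ncps_mulDl : left_distributive ncps_mul ncps_add.
Proof.
move=> S T U; apply/funext => u; rewrite /ncps_mul /ncps_add -big_split /=.
by apply: eq_bigr => i _; rewrite mulrDl.
Qed.

Fact ncps_mulDr : right_distributive ncps_mul ncps_add.
Proof.
move=> S T U; apply/funext => u; rewrite /ncps_mul /ncps_add -big_split /=.
by apply: eq_bigr => i _; rewrite mulrDr.
Qed.

Fact ncps_mul1l : left_id (ncps_const 1) ncps_mul.
Proof.
move=> S; apply/funext => -[|x u]; first by rewrite ncps_mul_nil mul1r.
rewrite ncps_mul_cons mul1r /ncps_mul big1 ?addr0 // => i _.
by rewrite /shift mul0r.
Qed.

Fact ncps_mul1r : right_id (ncps_const 1) ncps_mul.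
Proof.
move=> S; apply/funext => u; elim: u S => [|x u IHu] S.
  by rewrite ncps_mul_nil mulr1.
by rewrite ncps_mul_cons mulr0 add0r IHu.
Qed.

Fact ncps_mulA : associative ncps_mul.
Proof.
move=> S T U; apply/funext => u; elim: u S T U => [|x u IHu] S T U.
  by rewrite !ncps_mul_nil mulrA.
have eq_shift : shift x (ncps_mul S T) =
    ncps_add (fun v => S [::] * shift x T v) (ncps_mul (shift x S) T).
  by apply/funext => v; rewrite /shift ncps_mul_cons.
rewrite [in RHS]ncps_mul_cons eq_shift ncps_mulDl [in RHS]/ncps_add -IHu.
rewrite !ncps_mul_cons ncps_mul_nil mulrDr mulrA -addrA; congr (_ + (_ + _)).
by rewrite /ncps_mul mulr_sumr; apply: eq_bigr => i _; rewrite mulrA.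
Qed.

HB.instance Definition _ := GRing.isZmodule.Build (ncps R L)
  ncps_addA ncps_addC ncps_add0 ncps_addN.
HB.instance Definition _ := GRing.Zmodule_isPzRing.Build (ncps R L)
  ncps_mulA ncps_mul1l ncps_mul1r ncps_mulDl ncps_mulDr.

Lemma ncps0E u : (0 : ncps R L) u = 0.
Proof. by case: u. Qed.

Lemma ncpsDE S T u : (S + T) u = S u + T u.
Proof. by []. Qed.

Lemma ncpsNE S u : (- S) u = - S u.
Proof. by []. Qed.

Lemma ncpsME S T u :
  (S * T) u = \sum_(i < (size u).+1) S (take i u) * T (drop i u).
Proof. by []. Qed.

Lemma ncpsM_nil S T : (S * T) [::] = S [::] * T [::].
Proof. exact: ncps_mul_nil. Qed.

Lemma ncps_sumE (I : Type) (r : seq I) (P : pred I) (E : I -> ncps R L) u :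
  (\sum_(i <- r | P i) E i) u = \sum_(i <- r | P i) E i u.
Proof.
by elim/big_rec2: _ => [|i y S _ <-]; rewrite ?ncps0E ?ncpsDE.
Qed.

Lemma ncps_constM a S u : (ncps_const a * S) u = a * S u.
Proof.
rewrite ncpsME big_ord_recl take0 drop0 /= big1 ?addr0 // => i _.
by case: u i => [|x u] [] // l ltl; rewrite mul0r.
Qed.

End NcpsRing.

(** * The algebra M_m(F)<<x_1, ..., x_g>> *)

(* 𝒜 = 'M[F]_m.  𝒜^w has the basis
     e_(i0,j0) w_1 e_(i1,j1) w_2 ... w_k e_(ik,jk)
   (e_(i,j) matrix units), so a series is a family of coefficients indexed by
   these products.  We store the coefficient of the displayed product in the
   matrix attached to the sequence
     [:: (w_1, (j0,i1)); (w_2, (j1,i2)); ...; (w_k, (j(k-1),ik))],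
   at position (i0, jk).  With this bookkeeping the product of 𝒜<<x>>, where
   adjacent elements of 𝒜 are multiplied, is the product of [ncps]. *)
Definition mxps (F : fieldType) (m g : nat) :=
  ncps 'M[F]_m ('I_g * ('I_m * 'I_m)).

Section Mxps.
Variables (F : fieldType) (m g : nat).

Definition mxps_const (a : 'M[F]_m) : mxps F m g := ncps_const a.

(* x_k = \sum_(i, j) e_(i,i) x_k e_(j,j) *)
Definition mxps_var (k : 'I_g) : mxps F m g :=
  fun u => if u is [:: (k', (i, j))]
           then if k' == k then delta_mx i j else 0 else 0.

(* a_0 w_1 a_1 ... w_k a_k, with [s] listing the pairs (w_i, a_i) *)
Fixpoint mxps_pure (a0 : 'M[F]_m) (s : seq ('I_g * 'M[F]_m)) : mxps F m g :=
  if s is (k, a) :: s' then mxps_const a0 * mxps_var k * mxps_pure a s'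
  else mxps_const a0.

(* 𝒜^w; scalars are absorbed in the leading coefficients *)
Definition in_Aw (w : seq 'I_g) (T : mxps F m g) : Prop :=
  exists2 ps : seq ('M[F]_m * seq ('I_g * 'M[F]_m)),
    (forall p, p \in ps -> unzip1 p.2 = w) &
    T = \sum_(p <- ps) mxps_pure p.1 p.2.

(* [S, w] *)
Definition mxps_coef (S : mxps F m g) (w : seq 'I_g) : mxps F m g :=
  fun u => if unzip1 u == w then S u else 0.

(* If a = S [::] is invertible then S = a (1 - N), where N = 1 - a^-1 S has no
   constant term, so S^-1 = \sum_k N ^+ k a^-1 and only the terms with
   k <= size u contribute to the coefficient at u. *)
Definition mxps_inv (S : mxps F m g) : mxps F m g :=
  let b := mxps_const (invmx (S [::])) in
  fun u => \sum_(k < (size u).+1) ((1 - b * S) ^+ k * b) u.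

Lemma mxps_varM k (T : mxps F m g) u :
  (mxps_var k * T) u =
  if u is (k', (i, j)) :: u' then
    if k' == k then delta_mx i j * T u' else 0
  else 0.
Proof.
case: u => [|[k' [i j]] u]; first by rewrite ncpsM_nil mul0r.
rewrite ncpsME big_ord_recl mul0r add0r big_ord_recl big1 /=.
  by rewrite take0 drop0 addr0; case: eqP; rewrite ?mul0r.
by case: u => [|x u] [l ltl] //= _; rewrite mul0r.
Qed.

(* The pure products of matrix units form the expected basis. *)
Lemma mxps_pure_delta i j (s : seq ('I_g * ('I_m * 'I_m))) :
  let fix idx j (s : seq ('I_g * ('I_m * 'I_m))) :=
    if s is (k, (i1, j1)) :: s' then (k, (j, i1)) :: idx j1 s' else [::] in
  let last_col := last j [seq x.2.2 | x <- s] in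
  mxps_pure (delta_mx i j) [seq (x.1, delta_mx x.2.1 x.2.2) | x <- s] =
  (fun u => if u == idx j s then delta_mx i last_col else 0) :> mxps F m g.
Proof.
move=> idx; elim: s i j => [|[k [i1 j1]] s IHs] i j /=.
  by apply/funext => -[].
apply/funext => u; rewrite -mulrA ncps_constM mxps_varM IHs.
case: u => [|[k' [p q]] u] /=; first by rewrite mulr0.
rewrite eqseq_cons -[(k', _) == _]/((k' == k) && ((p == j) && (q == i1))).
have [_|_] := eqVneq k' k; last by rewrite mulr0.
have [_|_] /= := eqVneq u (idx j1 s); last by rewrite andbF !mulr0.
rewrite andbT -!mulmxE.
have [->|qN] := eqVneq q i1; last by rewrite mul_delta_mx_0 ?mulmx0 ?andbF.
rewrite mul_delta_mx; have [->|pN] := eqVneq p j; first by rewrite mul_delta_mx.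
by rewrite mul_delta_mx_0 // eq_sym.
Qed.

Lemma mxps_pure_supp a0 s u :
  unzip1 u != unzip1 s -> mxps_pure a0 s u = 0.
Proof.
elim: s a0 u => [|[k a] s IHs] a0 [|[k' [i j]] u] //=.
  by rewrite -mulrA ncps_constM mxps_varM mulr0.
rewrite eqseq_cons negb_and -mulrA ncps_constM mxps_varM.
by case: eqP => [_ /IHs ->|]; rewrite !mulr0.
Qed.

Lemma in_Aw_sum w (I : Type) (r : seq I) (T : I -> mxps F m g) :
  (forall i, in_Aw w (T i)) -> in_Aw w (\sum_(i <- r) T i).
Proof.
move=> Tw; elim/big_ind: _ => //; first by exists [::]; rewrite ?big_nil.
move=> _ _ [ps psw ->] [qs qsw ->]; exists (ps ++ qs); last by rewrite big_cat.
by move=> p; rewrite mem_cat => /orP[/psw|/qsw].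
Qed.

Lemma in_Aw_cons k w a T :
  in_Aw w T -> in_Aw (k :: w) (mxps_const a * mxps_var k * T).
Proof.
move=> [ps psw ->]; exists [seq (a, (k, p.1) :: p.2) | p <- ps].
  by move=> _ /mapP[p /psw pw ->]; rewrite /= pw.
by rewrite big_map mulr_sumr.
Qed.

(* 𝒜^w consists of the series supported on the indices with letters w. *)
Lemma in_AwP w (T : mxps F m g) :
  in_Aw w T <-> (forall u, unzip1 u != w -> T u = 0).
Proof.
split=> [[ps psw ->] u uw|].
  rewrite ncps_sumE big_seq big1 // => p /psw pw.
  by rewrite mxps_pure_supp ?pw.
elim: w T => [|k w IHw] T Tw.
  exists [:: (T [::], [::])]; first by move=> _ /[!inE]/eqP->.
  rewrite big_seq1; apply/funext => -[|x u] //=; exact: Tw.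
pose T' p j : mxps F m g :=
  fun u => \matrix_(i, q) T ((k, (j, i)) :: u) p q.
have -> : T = \sum_p \sum_j mxps_const (delta_mx p j) * mxps_var k * T' p j.
  apply/funext => u; rewrite ncps_sumE.
  under eq_bigr do rewrite ncps_sumE.
  case: u => [|[k' [j i]] u].
    rewrite Tw // big1 // => p _; rewrite big1 // => j _.
    by rewrite -mulrA ncps_constM mxps_varM mulr0.
  under eq_bigr do under eq_bigr do rewrite -mulrA ncps_constM mxps_varM.
  have [->|k'k] := eqVneq k' k; last first.
    rewrite Tw ?eqseq_cons ?negb_and ?k'k // big1 // => p _.
    by rewrite big1 // => q _; rewrite mulr0.
  apply/matrixP => p q; rewrite summxE (bigD1 p) //= summxE (bigD1 j) //=.
  rewrite -!mulmxE !mulmxA mul_delta_mx mxE (bigD1 i) //= !mxE !eqxx mul1r.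
  rewrite big1 => [|l li]; last by rewrite !mxE (negPf li) andbF mul0r.
  rewrite big1 => [|l lj]; last by rewrite mulmxA mul_delta_mx_0 ?mul0mx ?mxE.
  rewrite big1 ?addr0 // => p' p'p; rewrite summxE big1 // => l _.
  by rewrite mxE big1 // => l' _; rewrite !mxE eq_sym (negPf p'p) mul0r.
apply: in_Aw_sum => p; apply: in_Aw_sum => j; apply/in_Aw_cons/IHw => u uw.
apply/matrixP => i q; rewrite !mxE Tw ?mxE //.
by rewrite /= eqseq_cons eqxx.
Qed.

Lemma in_Aw_coef S w : in_Aw w (mxps_coef S w).
Proof. by apply/in_AwP => u /negPf uw; rewrite /mxps_coef uw. Qed.

Lemma mxps_inv_spec (S : mxps F m g) : S [::] \in unitmx ->
  mxps_inv S * S = 1 /\ S * mxps_inv S = 1.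
Proof.
move=> Su; pose a := mxps_const (S [::]); pose b := mxps_const (invmx (S [::])).
have constM (x y : 'M[F]_m) : mxps_const x * mxps_const y = mxps_const (x * y).
  by apply/funext => -[|z u]; rewrite ncps_constM //= mulr0.
have ab : a * b = 1 by rewrite constM -mulmxE mulmxV.
pose N := 1 - b * S.
have bS : b * S = 1 - N by rewrite /N opprB addrC subrK.
have eS : S = a * (1 - N) by rewrite -bS mulrA ab mul1r.
have N_nil : N [::] = 0.
  by rewrite /N ncpsDE ncpsNE ncpsM_nil -mulmxE mulVmx ?subrr.
have N0 k u : (size u < k)%N -> (N ^+ k) u = 0.
  elim: k u => // k IHk u uk; rewrite exprS ncpsME big_ord_recl take0.
  rewrite N_nil mul0r add0r.
  rewrite big1 // => i _; rewrite IHk ?mulr0 // size_drop.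
  case: u uk i => [|x u] // uk [i lti] //=.
  by rewrite /bump add1n subSS (leq_ltn_trans (leq_subr _ _)).
have Nl0 k u (T : mxps F m g) : (size u < k)%N -> (N ^+ k * T) u = 0.
  move=> uk; rewrite ncpsME big1 // => i _; rewrite N0 ?mul0r //.
  by rewrite (leq_ltn_trans _ uk) // size_take_min geq_minr.
pose P n := (\sum_(k < n) N ^+ k) * b.
have invE n u : (size u < n)%N -> mxps_inv S u = P n u.
  move=> un; rewrite /P mulr_suml ncps_sumE /mxps_inv -/b -/N.
  rewrite -(subnKC un) big_split_ord /= [X in _ + X]big1 ?addr0 // => i _.
  by rewrite Nl0 // ltnS leq_addr.
have geomr n : (1 - N) * (\sum_(k < n) N ^+ k) = 1 - N ^+ n.
  by rewrite -opprB mulNr -subrX1 opprB.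
have geoml n : (\sum_(k < n) N ^+ k) * (1 - N) = 1 - N ^+ n.
  rewrite -geomr; apply: commr_sym; apply: commr_sum => k _.
  by apply/commr_sym/commrB; [exact: commr1 | apply/commr_sym/commrX].
split; apply/funext => u.
  have -> : (mxps_inv S * S) u = (P (size u).+1 * S) u.
    rewrite !ncpsME; apply: eq_bigr => i _; rewrite (invE (size u).+1) //.
    by rewrite ltnS size_take_min geq_minr.
  by rewrite /P -mulrA bS geoml ncpsDE ncpsNE N0 // subr0.
have -> : (S * mxps_inv S) u = (S * P (size u).+1) u.
  rewrite !ncpsME; apply: eq_bigr => i _; rewrite (invE (size u).+1) //.
  by rewrite ltnS size_drop leq_subr.
rewrite {1}eS /P -!mulrA [(1 - N) * _]mulrA geomr mulrBl mul1r mulrBr ab.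
by rewrite ncpsDE ncpsNE ncps_constM Nl0 // mulr0 subr0.
Qed.

End Mxps.

(** * Noncommutative rational expressions and functions *)

Section Rational.
Variables (F : fieldType) (g : nat).

(* Noncommutative polynomials are the expressions without [RInv]. *)
Inductive ratexpr : Type :=
| RConst of F
| RVar of 'I_g
| RAdd of ratexpr & ratexpr
| RMul of ratexpr & ratexpr
| RInv of ratexpr.

Implicit Types r s : ratexpr.

Fixpoint rev_at m (a : 'I_g -> 'M[F]_m) r : 'M[F]_m :=
  match r with
  | RConst c => c%:M
  | RVar j => a j
  | RAdd r1 r2 => rev_at a r1 + rev_at a r2
  | RMul r1 r2 => rev_at a r1 *m rev_at a r2
  | RInv r1 => invmx (rev_at a r1)
  end.

Fixpoint rdom m (a : 'I_g -> 'M[F]_m) r : bool :=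
  match r with
  | RConst _ | RVar _ => true
  | RAdd r1 r2 | RMul r1 r2 => rdom a r1 && rdom a r2
  | RInv r1 => rdom a r1 && (rev_at a r1 \in unitmx)
  end.

(* Points are tuples of m x m matrices with m > 0: every expression is
   defined at the 0 x 0 matrices. *)
Definition nondegenerate r : Prop :=
  exists m (a : 'I_g -> 'M[F]_m), (0 < m)%N /\ rdom a r.

Definition ratequiv r s : Prop :=
  forall m (a : 'I_g -> 'M[F]_m), (0 < m)%N ->
    rdom a r -> rdom a s -> rev_at a r = rev_at a s.

Definition is_ratclass (C : ratexpr -> Prop) : Prop :=
  exists2 r, nondegenerate r & forall s, C s <-> nondegenerate s /\ ratequiv r s.

Record ncrat := NCRat {
  ncrat_class :> ratexpr -> Prop;
  ncratP : is_ratclass ncrat_class }.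

Definition ncrat_of r (hr : nondegenerate r) : ncrat :=
  NCRat (ex_intro2 _ _ r hr (fun s => iff_refl _)).

Lemma nondegenerate_const c : nondegenerate (RConst c).
Proof. by exists 1, (fun=> 0). Qed.

Definition ncrat0 : ncrat := ncrat_of (nondegenerate_const 0).

Implicit Types f : ncrat.

Definition ncrat_dom m (a : 'I_g -> 'M[F]_m) f : Prop :=
  exists2 r, f r & rdom a r.

(* The value at [a] of a representative defined at [a] (0 off the domain). *)
Definition ncrat_eval m (a : 'I_g -> 'M[F]_m) f : 'M[F]_m :=
  match pselect (exists r, f r /\ rdom a r) with
  | left h => rev_at a (projT1 (cid h))
  | right _ => 0
  end.

(* [\sum_j c_j f_j = 0], where the sum of classes is the class of the sum of
   representatives. *)
Definition ncrat_lindep l (f : 'I_l -> ncrat) : Prop :=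
  exists2 c : 'I_l -> F, exists j, c j != 0 &
  forall e : 'I_l -> ratexpr, (forall j, f j (e j)) ->
    ncrat0 (\big[RAdd/RConst 0]_(j < l) RMul (RConst (c j)) (e j)).

(** * Realizations *)

(* r(x_1 + p_1, ..., x_g + p_g) *)
Fixpoint expansion m (p : 'I_g -> 'M[F]_m) r : mxps F m g :=
  match r with
  | RConst c => mxps_const c%:M
  | RVar j => mxps_const (p j) + mxps_var F j
  | RAdd r1 r2 => expansion p r1 + expansion p r2
  | RMul r1 r2 => expansion p r1 * expansion p r2
  | RInv r1 => mxps_inv (expansion p r1)
  end.

(* By [mxps_inv_spec], every inversion in [expansion] is a genuine inverse
   when [p] is in the domain of the expression. *)
Lemma expansion_nil m (p : 'I_g -> 'M[F]_m) r :
  expansion p r [::] = rev_at p r.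
Proof.
elim: r => [c|j|r1 IH1 r2 IH2|r1 IH1 r2 IH2|r1 IH1] //=.
- by rewrite ncpsDE addr0.
- by rewrite ncpsDE IH1 IH2.
- by rewrite ncpsM_nil IH1 IH2.
- by rewrite /mxps_inv big_ord1 expr0 mul1r /mxps_const /ncps_const IH1.
Qed.

Definition Apow m n (A : 'I_g -> 'M[mxps F m g]_n) (w : seq 'I_g) :
  'M[mxps F m g]_n := foldr (fun k B => A k *m B) 1%:M w.

Definition realization m (p : 'I_g -> 'M[F]_m) f n
    (c : 'M['M[F]_m]_(1, n)) (A : 'I_g -> 'M[mxps F m g]_n)
    (b : 'M['M[F]_m]_(n, 1)) : Prop :=
  [/\ (0 < m)%N, ncrat_dom p f,
      forall k i j, in_Aw [:: k] (A k i j) &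
      forall r, f r -> rdom p r -> forall w : seq 'I_g,
        mxps_coef (expansion p r) w =
        (map_mx (@mxps_const F m g) c *m Apow A w *m map_mx (@mxps_const F m g) b) 0 0].

Definition has_realization f n : Prop :=
  exists m (p : 'I_g -> 'M[F]_m) c A b, @realization m p f n c A b.

Definition sylvester_degree f n : Prop :=
  has_realization f n /\ forall n', has_realization f n' -> (n <= n')%N.

End Rational.

(* Main.v *)
From HB Require Import structures.
From mathcomp Require Import all_boot all_order all_algebra.
From mathcomp Require Import boolp.
Require Import Defs.

(** A rational expression [e] can be computed by a linear pencil: scalar
    [D x D] matrices [L_0, ..., L_g], a row [c] and a column [b] such that
    [L(a) = L_0 + \sum_k L_k (x) a_k] is invertible exactly when [e] is defined
    at [a], and then [e(a) = c L(a)^-1 b] ([linearization]).  A pencil of least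
    size [D] among those that compute [e] on its domain is the substitute for a
    minimal realization.  About a point [p] of size [s], where [X = L(p)^-1],
    the expansion of [e] has the coefficients [S(u) = c G(u) b] with
    [G(u) = (-1)^|u| X L_u1 X ... L_uk X] ([expansion_pencil]).  If a nonzero row
    annihilates every [G(u) b], then the pencil is block triangular in suitable
    scalar bases and one of its diagonal blocks computes the same function
    ([pencil_reduce]); the same holds for columns annihilated by every [c G(u)],
    by transposition.  So for a pencil of least size these rows and columns span,
    and the Hankel matrix [S(vw)] has rank [D s] about every point
    ([minimal_pencil_le]).

    Hence [D] is at most the dimension of any realization, about any point of
    any size ([realization_degree]), and it is the same for two equivalent
    expressions, since these have the same expansion about a common point of
    their domains ([pencil_degree_agree]).  This is what carries a bound on the
    Sylvester degree, witnessed about a point of unknown size, to a common point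
    [p] of size [m].  Moreover a function whose expansion about one point is [0]
    has [D = 0] and vanishes on its whole domain.  Common points exist because
    a domain meets a line in the complement of the zeros of a determinant and
    [F] is infinite ([rdom_common]).

    Let now [S <> 0] be a linear combination of the expansions of [k] of the
    functions about [p], and [u] a shortest word with [S(u) <> 0].  The Hankel
    matrix indexed by the [|u| + 1] ways of splitting [u] is triangular with
    [S(u)] on its diagonal, and its rank is at most [k d m]; so
    [|u| < k d m].  Sending a series to the triangular matrix of its values at
    the contiguous factors of [u] is a ring morphism ([staircase]); applied to
    [x + p] it gives a point of size [(|u| + 1) m] at which the combination does
    not vanish, because [S(u)] is a corner of its value
    ([nonvanishing_point]).

    The functions are separated one at a time by direct sums of points.  If the
    first [k] of them take independent values at [a] but some combination of the
    first [k + 1] vanishes at [a], that combination is unique up to a scalar, and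
    it suffices to add to [a] a point of size at most [(k + 1) d m m] where it
    does not vanish ([separating_step]).  The total size is at most
    [m (1 + d m (1 + ... + l))], which is at most [N] because
    [l (l + 1) <= 3 l!].  So if the functions were independent, their values
    would be independent at some point of size [N]. *)

Set Implicit Arguments.
Unset Strict Implicit.
Unset Printing Implicit Defensive.

Import GRing.Theory.
Local Open Scope ring_scope.

(** * Matrices with matrix entries *)

Section Flat.
Variables (F : fieldType) (s : nat).

(** Inverse of [mxvec_index]. *)
Definition block_pos n (k : 'I_(n * s)) : 'I_n * 'I_s :=
  enum_val (cast_ord (esym (mxvec_cast n s)) k).

Lemma block_posK n (i : 'I_n) (j : 'I_s) : block_pos (mxvec_index i j) = (i, j).
Proof. by rewrite /block_pos cast_ordK enum_rankK. Qed.

(** The entries ['M_s] do not form a commutative ring; flattening the blocks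
    makes rank and determinant available. *)
Definition flat n1 n2 (A : 'M['M[F]_s]_(n1, n2)) : 'M[F]_(n1 * s, n2 * s) :=
  \matrix_(k, l) A (block_pos k).1 (block_pos l).1 (block_pos k).2 (block_pos l).2.

Definition unflat n1 n2 (B : 'M[F]_(n1 * s, n2 * s)) : 'M['M[F]_s]_(n1, n2) :=
  \matrix_(i, j) \matrix_(k, l) B (mxvec_index i k) (mxvec_index j l).

Lemma flatE n1 n2 (A : 'M['M[F]_s]_(n1, n2)) i j k l :
  flat A (mxvec_index i k) (mxvec_index j l) = A i j k l.
Proof. by rewrite mxE !block_posK. Qed.

Lemma flatK n1 n2 : cancel (@flat n1 n2) (@unflat n1 n2).
Proof.
by move=> A; apply/matrixP => i j; apply/matrixP => k l; rewrite !mxE !block_posK.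
Qed.

Lemma unflatK n1 n2 : cancel (@unflat n1 n2) (@flat n1 n2).
Proof.
move=> B; apply/matrixP => k l.
by case/mxvec_indexP: k => i k; case/mxvec_indexP: l => j l; rewrite flatE !mxE.
Qed.

Lemma big_mxvec_index n (f : 'I_(n * s) -> F) :
  \sum_k f k = \sum_i \sum_j f (mxvec_index i j).
Proof.
rewrite pair_big /= (reindex _ (curry_mxvec_bij n s)) /=.
by apply: eq_bigr => -[i j].
Qed.

Lemma flat_is_additive n1 n2 : zmod_morphism (@flat n1 n2).
Proof. by move=> A B; apply/matrixP => k l; rewrite !mxE. Qed.

HB.instance Definition _ n1 n2 :=
  GRing.isZmodMorphism.Build _ _ (@flat n1 n2) (@flat_is_additive n1 n2).

Lemma flatM n1 n2 n3 (A : 'M['M[F]_s]_(n1, n2)) (B : 'M['M[F]_s]_(n2, n3)) :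
  flat (A *m B) = flat A *m flat B.
Proof.
apply/matrixP => k l.
case/mxvec_indexP: k => i k; case/mxvec_indexP: l => j l.
rewrite flatE !mxE summxE big_mxvec_index; apply: eq_bigr => h _.
by rewrite mxE; apply: eq_bigr => h' _; rewrite !flatE.
Qed.

Lemma flat1 n : flat (1%:M : 'M_n) = 1%:M.
Proof.
apply/matrixP => k l.
case/mxvec_indexP: k => i k; case/mxvec_indexP: l => j l.
rewrite flatE mxE [RHS]mxE.
have -> : (mxvec_index i k == mxvec_index j l) = ((i == j) && (k == l)).
  apply/eqP/andP => [/(congr1 (@block_pos n))|[/eqP-> /eqP->] //].
  by rewrite !block_posK => -[-> ->].
by case: (i == j); rewrite mxE.
Qed.

Lemma flat_scalar n (t : F) : flat ((t%:M : 'M_s)%:M : 'M_n) = t%:M.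
Proof.
rewrite -[RHS]scalemx1 -(flat1 n); apply/matrixP => i j; rewrite !mxE.
by case: eqP => _; rewrite ?mulr1n ?mulr0n !mxE ?mulr0 // mulr_natr.
Qed.

Lemma flat_is_monoid_morphism n : monoid_morphism (@flat n n).
Proof. by split=> [|A B]; [exact: flat1 | exact: flatM]. Qed.

HB.instance Definition _ n :=
  GRing.isMonoidMorphism.Build _ _ (@flat n n) (@flat_is_monoid_morphism n).

(** Finite dimension over [F] makes the matrix rings over ['M_s] Dedekind
    finite. *)
Lemma bmulmx1C n (A B : 'M['M[F]_s]_n) : A *m B = 1%:M -> B *m A = 1%:M.
Proof.
move=> AB; apply: (can_inj (@flatK n n)); rewrite flatM flat1.
by apply: mulmx1C; rewrite -flatM AB flat1.
Qed.

Lemma flat_unitP n (A : 'M['M[F]_s]_n) :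
  reflect (exists B, A *m B = 1%:M) (flat A \in unitmx).
Proof.
apply: (iffP idP) => [Au|[B AB]].
  exists (unflat (invmx (flat A))); apply: (can_inj (@flatK n n)).
  by rewrite flatM unflatK mulmxV // flat1.
by have /mulmx1_unit[] : flat A *m flat B = 1%:M by rewrite -flatM AB flat1.
Qed.

End Flat.

Section Kron.
Variables (F : fieldType) (s : nat).
Implicit Types x y : 'M[F]_s.

(** The Kronecker product of [A] and [x], kept in blocks. *)
Definition kron n1 n2 (A : 'M[F]_(n1, n2)) x : 'M['M[F]_s]_(n1, n2) :=
  map_mx (fun t => t *: x) A.

Lemma kronM n1 n2 n3 (A : 'M[F]_(n1, n2)) (B : 'M[F]_(n2, n3)) x y :
  kron (A *m B) (x * y) = kron A x *m kron B y.
Proof.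
apply/matrixP => i j; rewrite !mxE scaler_suml; apply: eq_bigr => k _.
by rewrite !mxE -mulmxE -scalemxAl -scalemxAr scalerA.
Qed.

Lemma kron0 n1 n2 x : kron (0 : 'M[F]_(n1, n2)) x = 0.
Proof. by apply/matrixP => i j; rewrite !mxE scale0r. Qed.

Lemma kronN n1 n2 (A : 'M[F]_(n1, n2)) x : kron (- A) x = - kron A x.
Proof. by apply/matrixP => i j; rewrite !mxE scaleNr. Qed.

Lemma kron_scalar n (t : F) : kron (t%:M : 'M_n) 1 = (t%:M : 'M_s)%:M.
Proof.
by apply/matrixP => i j; rewrite !mxE; case: eqP; rewrite ?scale0r // scalemx1.
Qed.

Lemma kron1 n : kron (1%:M : 'M_n) 1 = 1%:M.
Proof. exact: kron_scalar. Qed.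

End Kron.

(** * Linear pencils *)

Section Pencil.
Variables (F : fieldType) (g : nat).

(** The constant term of a pencil is its coefficient at the variable [None],
    which is always evaluated at [1]. *)
Definition point1 s (a : 'I_g -> 'M[F]_s) (k : option 'I_g) : 'M[F]_s :=
  if k is Some i then a i else 1.

Definition pev n1 n2 (L : option 'I_g -> 'M[F]_(n1, n2)) s
    (a : 'I_g -> 'M[F]_s) : 'M['M[F]_s]_(n1, n2) :=
  \sum_k kron (L k) (point1 a k).

Record pencil := Pencil {
  pdim : nat;
  pcoef : option 'I_g -> 'M[F]_pdim;
  pout : 'rV[F]_pdim;
  pin : 'cV[F]_pdim }.

Definition invertible_at (P : pencil) s (a : 'I_g -> 'M[F]_s) : Prop :=
  exists B, pev (pcoef P) a *m B = 1%:M.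

Definition value_at (P : pencil) s (a : 'I_g -> 'M[F]_s) (x : 'M[F]_s) : Prop :=
  exists2 B, pev (pcoef P) a *m B = 1%:M &
    kron (pout P) 1 *m B *m kron (pin P) 1 = x%:M.

(** Only the values on the domain of [e] are prescribed, so that a pencil of
    least size may be invertible at further points. *)
Definition represents (P : pencil) (e : ratexpr F g) : Prop :=
  forall s (a : 'I_g -> 'M[F]_s), rdom a e -> value_at P a (rev_at a e).

Definition single_coef n1 n2 k0 (A : 'M[F]_(n1, n2)) (k : option 'I_g) :=
  if k == k0 then A else 0.

Lemma pev_single_coef n1 n2 k0 (A : 'M[F]_(n1, n2)) s (a : 'I_g -> 'M[F]_s) :
  pev (single_coef k0 A) a = kron A (point1 a k0).
Proof.
rewrite /pev (bigD1 k0) //= /single_coef eqxx big1 ?addr0 // => k /negPf->.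
by rewrite kron0.
Qed.

Lemma pev0 n1 n2 s (a : 'I_g -> 'M[F]_s) :
  pev (fun=> 0 : 'M[F]_(n1, n2)) a = 0.
Proof. by rewrite /pev big1 // => k _; rewrite kron0. Qed.

Lemma pev_block n1 n2 n3 n4 (A : option 'I_g -> 'M[F]_(n1, n2))
    (B : option 'I_g -> 'M[F]_(n1, n3)) (C : option 'I_g -> 'M[F]_(n4, n2))
    (D : option 'I_g -> 'M[F]_(n4, n3)) s (a : 'I_g -> 'M[F]_s) :
  pev (fun k => block_mx (A k) (B k) (C k) (D k)) a =
  block_mx (pev A a) (pev B a) (pev C a) (pev D a).
Proof.
rewrite /pev; elim: (index_enum _) => [|k r IHr].
  by rewrite !big_nil block_mx0.
by rewrite !big_cons IHr /kron map_block_mx add_block_mx.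
Qed.

End Pencil.

(** * Linearization of rational expressions *)

Section Linearization.
Variables (F : fieldType) (g : nat).

(** Invertibility characterizes the domain; this makes the domain the
    complement of the zeros of a determinant. *)
Definition linearizes (P : pencil F g) (e : ratexpr F g) : Prop :=
  represents P e /\ forall s (a : 'I_g -> 'M[F]_s), invertible_at P a -> rdom a e.

Definition const_pencil (t : F) : pencil F g :=
  @Pencil F g 1 (single_coef None 1%:M) t%:M 1%:M.

Definition var_pencil (j : 'I_g) : pencil F g :=
  @Pencil F g (1 + 1)
    (fun k => block_mx (single_coef None 1%:M k) (single_coef (Some j) (- 1%:M) k)
                       0 (single_coef None 1%:M k))
    (row_mx 1%:M 0) (col_mx 0 1%:M).

Definition add_pencil (P Q : pencil F g) : pencil F g :=
  Pencil (fun k => block_mx (pcoef P k) 0 0 (pcoef Q k))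
    (row_mx (pout P) (pout Q)) (col_mx (pin P) (pin Q)).

(** The inverse of [[L1, - b1 c2], [0, L2]] has [L1^-1 b1 c2 L2^-1] as its
    upper right block. *)
Definition mul_pencil (P Q : pencil F g) : pencil F g :=
  Pencil (fun k => block_mx (pcoef P k) (single_coef None (- (pin P *m pout Q)) k)
                            0 (pcoef Q k))
    (row_mx (pout P) 0) (col_mx 0 (pin Q)).

(** By the Schur complement, [[L, b], [c, 0]] is invertible together with [L]
    iff the value [c L^-1 b] is, and the lower right block of its inverse is
    the opposite of the inverse of that value.  The additional diagonal block
    [L] forces the argument of the inverse to be defined. *)
Definition inv_pencil (P : pencil F g) : pencil F g :=
  Pencil (fun k => block_mx
      (block_mx (pcoef P k) (single_coef None (pin P) k) (single_coef None (pout P) k) 0)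
      0 0 (pcoef P k))
    (row_mx (row_mx 0 1%:M) 0) (col_mx (col_mx 0 (- 1%:M)) 0).

Lemma kron_row s n n1 n2 (A : 'M[F]_(n, n1)) (B : 'M[F]_(n, n2)) (x : 'M[F]_s) :
  kron (row_mx A B) x = row_mx (kron A x) (kron B x).
Proof. exact: map_row_mx. Qed.

Lemma kron_col s n n1 n2 (A : 'M[F]_(n1, n)) (B : 'M[F]_(n2, n)) (x : 'M[F]_s) :
  kron (col_mx A B) x = col_mx (kron A x) (kron B x).
Proof. exact: map_col_mx. Qed.

Lemma const_pencilP t : linearizes (const_pencil t) (RConst g t).
Proof.
split=> // s a _; exists 1%:M; rewrite /= ?pev_single_coef ?kron1 ?mulmx1 //.
exact: kron_scalar.
Qed.

Lemma var_pencilP j : linearizes (var_pencil j) (RVar F j).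
Proof.
split=> // s a _; rewrite /value_at /= pev_block !pev_single_coef pev0 /= !kron1.
rewrite kronN; have -> : kron (1%:M : 'M_1) (a j) = (a j)%:M.
  by apply/matrixP => i k; rewrite !ord1 !mxE !eqxx scale1r.
exists (block_mx 1%:M (a j)%:M 0 1%:M).
  rewrite mulmx_block !mulmx1 !mul1mx !mulmx0 !mul0mx !addr0 !add0r subrr.
  by rewrite -scalar_mx_block.
rewrite kron_row kron_col !kron0 !kron1 mul_row_block mul_row_col.
by rewrite !mul1mx !mul0mx !mulmx0 !mulmx1 !addr0 add0r.
Qed.

Lemma add_pencilP P Q e1 e2 : linearizes P e1 -> linearizes Q e2 ->
  linearizes (add_pencil P Q) (RAdd e1 e2).
Proof.
move=> [rP dP] [rQ dQ]; split=> s a /=.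
  move=> /andP[/rP[B B1 Bv] /rQ[C C1 Cv]].
  rewrite /value_at /= pev_block !pev0; exists (block_mx B 0 0 C).
    by rewrite mulmx_block !mulmx0 !mul0mx !addr0 !add0r B1 C1 -scalar_mx_block.
  rewrite kron_row kron_col mul_row_block mul_row_col !mulmx0 addr0 add0r Bv Cv.
  by rewrite raddfD.
rewrite /invertible_at /= pev_block !pev0 => -[B].
rewrite -[B]submxK mulmx_block !mul0mx !addr0 !add0r scalar_mx_block.
move=> /eq_block_mx[B1 _ _ B2].
by apply/andP; split; [apply: dP; exists (ulsubmx B) | apply: dQ; exists (drsubmx B)].
Qed.

Lemma mul_pencilP P Q e1 e2 : linearizes P e1 -> linearizes Q e2 ->
  linearizes (mul_pencil P Q) (RMul e1 e2).
Proof.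
move=> [rP dP] [rQ dQ]; split=> s a /=.
  move=> /andP[/rP[B B1 Bv] /rQ[C C1 Cv]].
  rewrite /value_at /= pev_block !pev0 pev_single_coef /= kronN -[X in kron _ X]mulr1 kronM.
  set b := kron (pin P) 1; set c := kron (pout Q) 1.
  exists (block_mx B (B *m b *m c *m C) 0 C).
    rewrite mulmx_block !mulmx0 !mul0mx !addr0 !add0r B1 C1 !mulmxA B1 mul1mx.
    by rewrite mulNmx subrr -scalar_mx_block.
  rewrite kron_row kron_col !kron0 mul_row_block mul_row_col !mulmx0 !mul0mx.
  rewrite !addr0 add0r !mulmxA Bv -!mulmxA (mulmxA c) Cv.
  by rewrite -scalar_mxM.
rewrite /invertible_at /= pev_block !pev0 => -[B].
rewrite -[B]submxK mulmx_block !mul0mx !add0r scalar_mx_block.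
move=> /eq_block_mx[B1 _ B3 B4].
have Q1 : drsubmx B *m pev (pcoef Q) a = 1%:M by exact: bmulmx1C.
have B30 : dlsubmx B = 0 by rewrite -[LHS]mul1mx -Q1 -mulmxA B3 mulmx0.
rewrite B30 mulmx0 addr0 in B1.
by apply/andP; split; [apply: dP; exists (ulsubmx B) | apply: dQ; exists (drsubmx B)].
Qed.

Lemma inv_pencilP P e : linearizes P e -> linearizes (inv_pencil P) (RInv e).
Proof.
move=> [rP dP]; split=> s a /=.
  move=> /andP[/rP[B B1 Bv] xu].
  rewrite /value_at /= !pev_block !pev0 !pev_single_coef /=.
  set b := kron (pin P) 1; set c := kron (pout P) 1; rewrite -/b -/c in Bv.
  set x := rev_at a e in xu Bv *; pose y : 'M['M[F]_s]_1 := (invmx x)%:M.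
  have xy : x%:M *m y = 1%:M by rewrite -scalar_mxM -mulmxE mulmxV.
  exists (block_mx (block_mx (B - B *m b *m y *m c *m B) (B *m b *m y)
                             (y *m c *m B) (- y)) 0 0 B).
    rewrite !mulmx_block !mulmx0 !mul0mx !addr0 !add0r B1 !mulmxBr !mulmxA B1 Bv.
    by rewrite xy !mul1mx subrK mulmxN !subrr -!scalar_mx_block.
  rewrite !kron_row !kron_col !kron0 kronN !kron1 !mul_row_block !mul_row_col.
  rewrite !mul0mx !mulmx0 !addr0 !add0r !mul1mx mul_row_col mulmx0 add0r.
  by rewrite mulmxN mulmx1 opprK.
rewrite /invertible_at /= !pev_block !pev0 !pev_single_coef /= => -[B].
set b := kron (pin P) 1; set c := kron (pout P) 1.
rewrite -[B]submxK mulmx_block !mul0mx !addr0 !add0r scalar_mx_block.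
move=> /eq_block_mx[B1 _ _ B4].
have dPa : rdom a e by apply: dP; exists (drsubmx B).
rewrite dPa /=; have [C C1 Cv] := rP _ _ dPa.
move: B1; rewrite -[ulsubmx B]submxK mulmx_block !mul0mx !addr0 scalar_mx_block.
set S := drsubmx _; set Q := ursubmx _ => /eq_block_mx[_ B2 _ B3].
have Q1 : Q = - (C *m b *m S).
  rewrite -[Q]mul1mx -(bmulmx1C C1) -[LHS]mulmxA -mulmxA -mulmxN; congr (_ *m _).
  by apply/eqP; rewrite -addr_eq0 B2.
have : rev_at a e *m (- S 0 0) = 1%:M.
  move/matrixP/(_ 0 0): B3; rewrite Q1 mulmxN !mulmxA Cv mul_scalar_mx !mxE.
  by rewrite eqxx mulmxN.
by case/mulmx1_unit.
Qed.

Lemma linearization e : exists P, linearizes P e.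
Proof.
elim: e => [t|j|e1 [P hP] e2 [Q hQ]|e1 [P hP] e2 [Q hQ]|e [P hP]].
- by exists (const_pencil t); exact: const_pencilP.
- by exists (var_pencil j); exact: var_pencilP.
- by exists (add_pencil P Q); exact: add_pencilP.
- by exists (mul_pencil P Q); exact: mul_pencilP.
- by exists (inv_pencil P); exact: inv_pencilP.
Qed.

End Linearization.

(** * Common points of domains *)

Lemma invmx_eq (F : fieldType) n (A B : 'M[F]_n) : A *m B = 1%:M ->
  A \in unitmx /\ invmx A = B.
Proof.
move=> AB; have [Au _] := mulmx1_unit AB.
by split=> //; rewrite -[invmx A]mulmx1 -AB mulKmx.
Qed.

Section DirectSum.
Variables (F : fieldType) (g : nat).

Definition dsum n1 n2 (a : 'I_g -> 'M[F]_n1) (b : 'I_g -> 'M[F]_n2)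
  (k : 'I_g) : 'M[F]_(n1 + n2) := block_mx (a k) 0 0 (b k).

Lemma dsumP n1 n2 (a : 'I_g -> 'M[F]_n1) (b : 'I_g -> 'M[F]_n2) e :
  rdom a e -> rdom b e ->
  rdom (dsum a b) e /\
  rev_at (dsum a b) e = block_mx (rev_at a e) 0 0 (rev_at b e).
Proof.
elim: e => [t|j|e1 IH1 e2 IH2|e1 IH1 e2 IH2|e IH] //=.
- by split=> //; rewrite -scalar_mx_block.
- move=> /andP[/IH1 h1 /IH2 h2] /andP[/h1[-> ->] /h2[-> ->]]; split=> //.
  by rewrite add_block_mx !addr0.
- move=> /andP[/IH1 h1 /IH2 h2] /andP[/h1[-> ->] /h2[-> ->]]; split=> //.
  by rewrite mulmx_block !mulmx0 !mul0mx !addr0 !add0r.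
move=> /andP[/IH h au] /andP[/h[-> ->] bu].
apply: invmx_eq.
by rewrite mulmx_block !mulmx0 !mul0mx !addr0 !add0r !mulmxV // -scalar_mx_block.
Qed.

End DirectSum.

Section Generic.
Variables (F : fieldType) (g : nat).
Hypothesis char0 : [pchar F] =i pred0.

Lemma nonroot_ex (q : {poly F}) : q != 0 -> exists t, q.[t] != 0.
Proof.
move=> q0; apply/not_existsP => qroot.
(* In characteristic [0] the natural numbers are pairwise distinct. *)
pose rs := [seq n%:R : F | n <- iota 0 (size q)].
have : (size rs < size q)%N.
  apply: max_poly_roots => //.
    by apply/allP => t _; apply/rootP; apply: contrapT => /eqP; exact: qroot.
  rewrite map_inj_uniq ?iota_uniq // => i j.
  have natf n : n%:R = 0 :> F -> n = 0%N.
    by move/eqP; rewrite (iffLR (pcharf0P F) char0) => /eqP.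
  wlog ij : i j / (i <= j)%N.
    by move=> h; case: (leqP i j) => [/h//|/ltnW/h h' /esym/h' ->].
  move=> /esym eqij; apply/esym; rewrite -(subnK ij) (natf (j - i)%N) //.
  by rewrite natrB // eqij subrr.
by rewrite size_map size_iota ltnn.
Qed.

(** The polynomial is the determinant of the pencil of [e] along the line. *)
Lemma rdom_line n (a b : 'I_g -> 'M[F]_n) e : rdom a e \/ rdom b e ->
  exists2 q : {poly F}, q != 0 &
    forall t, q.[t] != 0 -> rdom (fun k => a k + t *: (b k - a k)) e.
Proof.
have [P [rP dP]] := linearization e.
pose A := flat (pev (pcoef P) a); pose B := flat (pev (pcoef P) b).
pose q := \det (map_mx polyC A + 'X *: map_mx polyC (B - A)).
have qE t : q.[t] = \det (A + t *: (B - A)).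
  rewrite -horner_evalE -det_map_mx; congr (\det _).
  by apply/matrixP => i j; rewrite !mxE /= /horner_eval !hornerE.
have unitE s (c : 'I_g -> 'M[F]_s) : rdom c e -> \det (flat (pev (pcoef P) c)) != 0.
  by move=> /rP[C C1 _]; rewrite -unitfE -unitmxE; apply/flat_unitP; exists C.
move=> dom; exists q.
  apply/eqP => q0; case: dom => /unitE /eqP; apply.
    by have := qE 0; rewrite q0 horner0 scale0r addr0.
  by have := qE 1; rewrite q0 horner0 scale1r subrKC.
move=> t qt; apply/dP/flat_unitP; rewrite unitmxE unitfE.
move: qt; rewrite qE; congr (\det _ != 0).
rewrite /A /B -raddfB; apply/matrixP => i j; rewrite !mxE /pev !summxE.
rewrite -sumrB mulr_sumr.
rewrite -big_split; apply: eq_bigr => -[k|] _ /=; rewrite !mxE.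
  by rewrite -mulrBr mulrCA -mulrDr.
by rewrite subrr mulr0 addr0.
Qed.

Lemma rdom_common n (a b : 'I_g -> 'M[F]_n) e1 e2 :
  rdom a e1 -> rdom b e2 -> exists c : 'I_g -> 'M[F]_n, rdom c (RAdd e1 e2).
Proof.
move=> a1 b2.
have [q1 q10 h1] := rdom_line (or_introl a1 : _ \/ rdom b e1).
have [q2 q20 h2] := rdom_line (or_intror b2 : rdom a e2 \/ _).
have [|t] := @nonroot_ex (q1 * q2); first by rewrite mulf_neq0.
rewrite hornerM mulf_eq0 negb_or => /andP[/h1 ? /h2 ?].
by eexists; apply/andP; split; eassumption.
Qed.

(** Direct sums of copies of one point. *)
Lemma rdom_amplify n k e : (exists a : 'I_g -> 'M[F]_n, rdom a e) ->
  exists a : 'I_g -> 'M[F]_(k.+1 * n), rdom a e.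
Proof.
move=> [a ae]; elim: k => [|k [b be]]; first by rewrite mul1n; exists a.
by rewrite mulSn; exists (dsum a b); case: (dsumP ae be).
Qed.

Lemma nondegenerateD (e1 e2 : ratexpr F g) :
  nondegenerate e1 -> nondegenerate e2 -> nondegenerate (RAdd e1 e2).
Proof.
move=> [m [a [m_gt0 ae]]] [n [b [n_gt0 be]]].
have := rdom_amplify n.-1 (ex_intro (fun c : 'I_g -> 'M_m => rdom c e1) a ae).
have := rdom_amplify m.-1 (ex_intro (fun c : 'I_g -> 'M_n => rdom c e2) b be).
rewrite !prednK // mulnC => -[b' be'] [a' ae'].
by have [c cd] := rdom_common ae' be'; exists (n * m)%N, c; rewrite muln_gt0 n_gt0.
Qed.

End Generic.

(** * Reducing a pencil *)

Section Subspace.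
Variable F : fieldType.

(** Conditions that are linear in the rows of [V] define a subspace of the row
    space.  Stating them for matrices with any number of rows, rather than for
    single rows, makes them apply to a basis of the subspace at once. *)
Lemma row_space_ex D (Pr : forall n, 'M[F]_(n, D) -> Prop) :
  Pr 0%N 0 ->
  (forall n1 n2 (A : 'M_(n1, n2)) (V : 'M_(n2, D)), Pr n2 V -> Pr n1 (A *m V)) ->
  (forall n1 n2 (V : 'M_(n1, D)) (W : 'M_(n2, D)),
     Pr n1 V -> Pr n2 W -> Pr (n1 + n2)%N (col_mx V W)) ->
  exists r (Y : 'M[F]_(r, D)),
    row_free Y /\ forall n (V : 'M_(n, D)), Pr n V <-> (V <= Y)%MS.
Proof.
move=> Pr0 PrM PrC.
pose Q k := `[< exists2 Y : 'M[F]_(k, D), row_free Y & Pr k Y >].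
have Q0 : exists k, Q k by exists 0%N; apply/asboolP; exists 0; rewrite // /row_free mxrank0.
have Qle k : Q k -> (k <= D)%N.
  by move=> /asboolP[Y /eqP Yfree _]; rewrite -Yfree rank_leq_col.
case: (ex_maxnP Q0 Qle) => r /asboolP[Y Yfree PrY] rmax.
exists r, Y; split=> // n V; split; last by move=> /submxP[A ->]; exact: PrM.
move=> PrV; pose W := row_base (col_mx Y V).
have WYV : (W :=: col_mx Y V)%MS := eq_row_base _.
have : Q (\rank (col_mx Y V)).
  apply/asboolP; exists W; first exact: row_base_free.
  have /submxP[A ->] : (W <= col_mx Y V)%MS by rewrite WYV.
  exact/PrM/PrC.
move=> /rmax rk.
have YYV : (Y <= col_mx Y V)%MS by rewrite -addsmxE addsmxSl.
apply: (submx_trans (_ : V <= col_mx Y V)%MS); first by rewrite -addsmxE addsmxSr.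
by rewrite -(mxrank_leqif_sup YYV) eqn_leq mxrankS //= (eqP Yfree).
Qed.

Lemma row_free_complete r D (Y : 'M[F]_(r, D)) : row_free Y ->
  exists (Y1 : 'M_(D - r, D)) (U : 'M_(D, r + (D - r))),
    col_mx Y Y1 *m U = 1%:M /\ U *m col_mx Y Y1 = 1%:M.
Proof.
move=> Yfree; have rD : (r <= D)%N by rewrite -(eqP Yfree) rank_leq_col.
have [Y1 Y1C] : exists Y1 : 'M_(D - r, D), (Y1 :=: Y^C)%MS.
  have <- : \rank (Y^C)%MS = (D - r)%N by rewrite mxrank_compl (eqP Yfree).
  by exists (row_base Y^C)%MS; exact: eq_row_base.
have full : row_full (col_mx Y Y1).
  by rewrite /row_full -addsmxE (adds_eqmx (eqmx_refl Y) Y1C); exact: addsmx_compl_full.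
have [U UT] := row_fullP full.
have [|V TV] := @row_freeP _ _ _ (col_mx Y Y1) _.
  by rewrite /row_free (eqP full) subnKC.
exists Y1, U; split=> //.
by rewrite -[U]mulmx1 -TV (mulmxA U) UT mul1mx.
Qed.

End Subspace.

Section Words.
Variables (F : fieldType) (g s : nat) (P : pencil F g).
Implicit Types (w : seq ('I_g * ('I_s * 'I_s))).

Definition letter_coef (x : 'I_g * ('I_s * 'I_s)) : 'M['M[F]_s]_(pdim P) :=
  kron (pcoef P (Some x.1)) (delta_mx x.2.1 x.2.2).

(** When [X] is the inverse of the pencil at [p], these are the coefficients of
    the inverse of the pencil at [x + p]: the Neumann series of
    [(L(p) + \sum_k L_k x_k)^-1]. *)
Fixpoint pword (X : 'M['M[F]_s]_(pdim P)) w :=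
  if w is x :: w' then - (X *m letter_coef x *m pword X w') else X.

End Words.
Arguments letter_coef {F g s} P x.
Arguments pword {F g s} P X w.

Section PevMul.
Variables (F : fieldType) (g s : nat) (a : 'I_g -> 'M[F]_s).

Lemma pevMl n1 n2 n3 (A : 'M[F]_(n1, n2)) (L : option 'I_g -> 'M[F]_(n2, n3)) :
  pev (fun k => A *m L k) a = kron A 1 *m pev L a.
Proof.
by rewrite /pev mulmx_sumr; apply: eq_bigr => k _; rewrite -kronM mul1r.
Qed.

Lemma pevMr n1 n2 n3 (L : option 'I_g -> 'M[F]_(n1, n2)) (A : 'M[F]_(n2, n3)) :
  pev (fun k => L k *m A) a = pev L a *m kron A 1.
Proof.
by rewrite /pev mulmx_suml; apply: eq_bigr => k _; rewrite -kronM mulr1.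
Qed.

End PevMul.

Section Slice.
Variables (F : fieldType) (s : nat).

Definition slice n1 n2 i j (A : 'M['M[F]_s]_(n1, n2)) : 'M[F]_(n1, n2) :=
  map_mx (fun x : 'M[F]_s => x i j) A.

Lemma slice_mulkron n1 n2 n3 i j (A : 'M['M[F]_s]_(n1, n2)) (B : 'M[F]_(n2, n3)) :
  slice i j (A *m kron B 1) = slice i j A *m B.
Proof.
apply/matrixP => k l; rewrite mxE [RHS]mxE mxE summxE; apply: eq_bigr => h _.
by rewrite [kron _ _ _ _]mxE -mulmxE -scalemxAr mulmx1 !mxE mulrC.
Qed.

(** Multiplying by matrix units on both sides and summing isolates one entry of
    each block. *)
Lemma kron_slice n1 n2 n3 i j (A : 'M['M[F]_s]_(n1, n2)) (B : 'M[F]_(n2, n3)) :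
  kron (slice i j A *m B) 1 =
  \sum_r ((delta_mx r i)%:M *m (A *m kron B (delta_mx j r))).
Proof.
have unit_sum (x : 'M[F]_s) :
    \sum_r delta_mx r i * x * delta_mx j r = (x i j)%:M.
  rewrite -[RHS]scalemx1 mx1_sum_delta scaler_sumr; apply: eq_bigr => r _.
  rewrite -!mulmxE -(mul_delta_mx (0 : 'I_1) r i) -(mul_delta_mx (0 : 'I_1) j r).
  rewrite -!mulmxA (mulmxA _ x) (mulmxA _ _ (delta_mx 0 r)).
  have -> : delta_mx 0 i *m x *m delta_mx j 0 = (x i j)%:M :> 'M_1.
    by apply/matrixP => k l; rewrite !ord1 -rowE -colE !mxE eqxx.
  by rewrite mul_scalar_mx -scalemxAr mul_delta_mx.
apply/matrixP => k l; rewrite summxE [LHS]mxE [X in X *: _]mxE.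
under [RHS]eq_bigr do rewrite mul_scalar_mx 2!mxE mulr_sumr.
rewrite exchange_big /= scaler_suml; apply: eq_bigr => h _.
rewrite !mxE mulrC -scalerA scalemx1 -unit_sum scaler_sumr; apply: eq_bigr => r _.
by rewrite mxE -mulmxE -!scalemxAr mulmxA.
Qed.

End Slice.

Section Reduction.
Variables (F : fieldType) (g : nat).

Lemma bmulmx1_min s n1 n2 (A : 'M['M[F]_s]_(n1, n2)) (B : 'M_(n2, n1)) :
  (0 < s)%N -> A *m B = 1%:M -> (n1 <= n2)%N.
Proof.
move=> s_gt0 AB; rewrite -(leq_pmul2r s_gt0).
by apply: (@mulmx1_min _ _ _ (flat A) (flat B)); rewrite -flatM AB flat1.
Qed.

Lemma sum_option (V : zmodType) (f : option 'I_g -> V) :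
  \sum_k f k = f None + \sum_i f (Some i).
Proof.
rewrite (bigD1 None) //= (reindex_omap Some id) => [|[]] //=.
by congr (_ + _); apply: eq_bigl => i; rewrite eqxx.
Qed.

Definition refines (Q P : pencil F g) : Prop :=
  forall s (a : 'I_g -> 'M[F]_s) x, value_at P a x -> value_at Q a x.

(** If [Y] and [Z] are completed to scalar bases, the pencil becomes
    [[M, 0], [_, Q]] and [b] becomes [[0], [Y1 b]], so that only the inverse of
    the block [Q] contributes to the value.  The block [M] is square, hence
    invertible wherever the pencil is. *)
Lemma refines_block (P : pencil F g) r (Y Z : 'M[F]_(r, pdim P))
    (M : option 'I_g -> 'M[F]_r) :
  row_free Y -> row_free Z -> (forall k, Y *m pcoef P k = M k *m Z) ->
  Y *m pin P = 0 ->
  exists2 Q, refines Q P & pdim Q = (pdim P - r)%N.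
Proof.
move=> /row_free_complete[Y1 [U [YU UY]]] /row_free_complete[Z1 [W [ZW WZ]]] YL Yb.
pose Q := Pencil (fun k => Y1 *m pcoef P k *m rsubmx W) (pout P *m rsubmx W)
  (Y1 *m pin P).
exists Q => // s a x [B LB Bx].
have YZW : Z *m W = row_mx 1%:M 0.
  rewrite -[Z](col_mxKu _ Z1) -[W]hsubmxK; set T := col_mx Z Z1.
  have : usubmx (T *m W) = usubmx (1%:M : 'M_(r + _)) by rewrite ZW.
  by rewrite mul_usub_mx hsubmxK => ->; rewrite scalar_mx_block col_mxKu.
have kYU : kron (col_mx Y Y1) (1 : 'M[F]_s) *m kron U 1 = 1%:M.
  by rewrite -kronM YU mulr1 kron1.
have kUY : kron U (1 : 'M[F]_s) *m kron (col_mx Y Y1) 1 = 1%:M.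
  by rewrite -kronM UY mulr1 kron1.
have kWZ : kron W (1 : 'M[F]_s) *m kron (col_mx Z Z1) 1 = 1%:M.
  by rewrite -kronM WZ mulr1 kron1.
pose N := kron (col_mx Z Z1) 1 *m B *m kron U 1.
have : kron (col_mx Y Y1) 1 *m pev (pcoef P) a *m kron W 1 *m N = 1%:M.
  by rewrite /N -!mulmxA (mulmxA (kron W 1)) kWZ mul1mx (mulmxA (pev _ _)) LB mul1mx.
rewrite -pevMl -pevMr.
have -> : (fun k => col_mx Y Y1 *m pcoef P k *m W) =
    (fun k => block_mx (M k) 0 (Y1 *m pcoef P k *m lsubmx W) (pcoef Q k)).
  apply/funext => k; rewrite mul_col_mx YL mul_col_mx -mulmxA YZW mul_mx_row.
  by rewrite mulmx1 mulmx0 -[W in LHS]hsubmxK mul_mx_row.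
rewrite pev_block pev0 -[N]submxK mulmx_block !mul0mx !addr0 scalar_mx_block.
move=> /eq_block_mx[M1 M2 _ Q1].
have N12 : ursubmx N = 0.
  by rewrite -[LHS]mul1mx -(bmulmx1C M1) -mulmxA M2 mulmx0.
rewrite N12 mulmx0 add0r in Q1.
exists (drsubmx N) => //; rewrite -Bx.
transitivity (kron (pout P) 1 *m kron W 1 *m N *m (kron (col_mx Y Y1) 1 *m kron (pin P) 1)).
  rewrite -[RHS]/(_ *m _) -!kronM mul_col_mx Yb -[W in RHS]hsubmxK mul_mx_row.
  rewrite !mulr1 kron_row kron_col kron0 -[N in RHS]submxK N12 mul_row_block mul_row_col.
  by rewrite !mulmx0 add0r add0r /=.
rewrite /N -!mulmxA (mulmxA (kron U 1)) kUY mul1mx (mulmxA (kron W 1)) kWZ.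
by rewrite mul1mx.
Qed.

Variables (s : nat) (P : pencil F g) (p : 'I_g -> 'M[F]_s).
Variable (X : 'M['M[F]_s]_(pdim P)).
Hypotheses (s_gt0 : (0 < s)%N) (LX : pev (pcoef P) p *m X = 1%:M).

(** The annihilator of the states [G(w) b] reachable about [p]. *)
Definition reach_null n (phi : 'M['M[F]_s]_(n, pdim P)) : Prop :=
  forall w, phi *m pword P X w *m kron (pin P) 1 = 0.

(** The scalar rows whose multiples by all of ['M_s] annihilate the reachable
    states. *)
Definition null_source n (V : 'M[F]_(n, pdim P)) : Prop := reach_null (kron V 1).

(** The scalar rows whose multiples annihilate the images of the reachable
    states under [L(p)].  These images are spanned by [b] and the
    [L_k x G(w) b], where [x] ranges over ['M_s]; this is why the annihilator is
    determined by scalar rows. *)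
Definition null_target n (V : 'M[F]_(n, pdim P)) : Prop :=
  V *m pin P = 0 /\ forall k, null_source (V *m pcoef P (Some k)).

Lemma null_source_kron n (V : 'M[F]_(n, pdim P)) x w : null_source V ->
  kron V x *m pword P X w *m kron (pin P) 1 = 0.
Proof.
move=> nV; have -> : kron V x = x%:M *m kron V 1.
  rewrite mul_scalar_mx; apply/matrixP => i j; rewrite !mxE.
  by rewrite -mulmxE -scalemxAr mulmx1.
by rewrite -!mulmxA [kron V 1 *m _]mulmxA nV mulmx0.
Qed.

Lemma null_source_mul n n' (V : 'M[F]_(n, n')) (L : 'M_(n', pdim P)) x w :
  null_source (V *m L) ->
  kron V 1 *m kron L x *m pword P X w *m kron (pin P) 1 = 0.
Proof. by move=> /(null_source_kron (1 * x) w); rewrite kronM. Qed.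

(** For [k = None] the coefficient is [L(p) - \sum_i L_i p_i], and [L(p)] cancels
    the factor [X] at the head of [G(w)]. *)
Lemma null_target_coef n (V : 'M[F]_(n, pdim P)) k :
  null_target V -> null_source (V *m pcoef P k).
Proof.
case: k => [k|] [Vb VL] w; first exact: VL.
rewrite -[X in kron _ X]mulr1 kronM.
have -> : kron (pcoef P None) 1 =
    pev (pcoef P) p - \sum_i kron (pcoef P (Some i)) (p i).
  by rewrite /pev sum_option addrK.
have nsum : kron V 1 *m (\sum_i kron (pcoef P (Some i)) (p i)) *m pword P X w *m
    kron (pin P) 1 = 0.
  by rewrite mulmx_sumr !mulmx_suml big1 // => i _; exact/null_source_mul/VL.
rewrite mulmxBr !mulmxBl nsum subr0 {nsum}.
case: w => [|[k [i j]] w] /=.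
  by rewrite -(mulmxA (kron V 1)) LX mulmx1 -[X in kron V X]mulr1 -[RHS](kron0 _ _ (1 * 1)) -Vb kronM mulr1.
rewrite mulmxN mulNmx -!mulmxA (mulmxA (pev _ _)) LX mul1mx !mulmxA.
by rewrite (null_source_mul _ _ (VL k)) oppr0.
Qed.

(** [phi X L_k x G(w) b = 0] for every matrix unit [x], and matrix units separate
    the slices of [phi X]. *)
Lemma reach_null_slice n (phi : 'M['M[F]_s]_(n, pdim P)) i j :
  reach_null phi -> null_target (slice i j (phi *m X)).
Proof.
move=> nphi; split.
  rewrite -slice_mulkron (nphi [::]).
  by apply/matrixP => k l; rewrite !mxE.
move=> k w; rewrite kron_slice !mulmx_suml big1 // => r _.
have := nphi ((k, (j, r)) :: w); rewrite /= mulmxN mulNmx !mulmxA => /eqP.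
by rewrite oppr_eq0 -!mulmxA => /eqP->; rewrite mulmx0.
Qed.

(** [null_target] and [null_source] are given by scalar row spaces [Y] and [Z]
    with [Y L_k <= Z] for all [k].  Right multiplication by [L(p)] maps the
    ['M_s]-multiples of [Y] bijectively onto those of [Z], so [Y] and [Z] have
    the same number of rows, and the pencil is block triangular.  The slices of
    [phi X] belong to [Y], so [Y] is not empty. *)
Lemma pencil_reduce n (phi : 'M['M[F]_s]_(n, pdim P)) :
  reach_null phi -> phi != 0 ->
  exists2 Q, refines Q P & (pdim Q < pdim P)%N.
Proof.
move=> nphi phi0.
have kronMl n1 n2 (A : 'M_(n1, n2)) (V : 'M[F]_(n2, pdim P)) :
    null_source V -> null_source (A *m V).
  move=> nV w; rewrite -[X in kron _ X]mulr1 kronM -!mulmxA.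
  by rewrite (mulmxA _ (pword _ _ _)) nV mulmx0.
have kronC n1 n2 (V : 'M[F]_(n1, pdim P)) (W : 'M[F]_(n2, pdim P)) :
    null_source V -> null_source W -> null_source (col_mx V W).
  by move=> nV nW w; rewrite kron_col !mul_col_mx nV nW col_mx0.
have [|||r [Y [Yfree YP]]] := @row_space_ex F _ (fun n => @null_target n).
- split=> [|k w]; first by rewrite mul0mx.
  by rewrite mul0mx kron0 !mul0mx.
- move=> n1 n2 A V [Vb VL]; split=> [|k]; first by rewrite -mulmxA Vb mulmx0.
  by rewrite -mulmxA; exact/kronMl.
- move=> n1 n2 V W [Vb VL] [Wb WL]; split=> [|k].
    by rewrite mul_col_mx Vb Wb col_mx0.
  by rewrite mul_col_mx; exact: kronC.
have [|r' [Z [Zfree ZP]]] := @row_space_ex F _ (fun n => @null_source n) _ kronMl kronC.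
  by move=> w; rewrite kron0 !mul0mx.
have [nYb nYL] : null_target Y by apply/YP.
have /row_freeP[Y' YY'] := Yfree; have /row_freeP[Z' ZZ'] := Zfree.
(* The slices of [psi X] lie in the row space of [Y], on which [Y' Y] is the
   identity. *)
have sliceY n' (psi : 'M['M[F]_s]_(n', pdim P)) : reach_null psi ->
    psi *m X = psi *m X *m kron Y' 1 *m kron Y 1.
  move=> npsi; apply/matrixP => k l; apply/matrixP => i j.
  have : slice i j (psi *m X) = slice i j (psi *m X) *m Y' *m Y.
    have /YP/submxP[A ->] := reach_null_slice i j npsi.
    by rewrite -(mulmxA A) YY' mulmx1.
  by rewrite -!slice_mulkron => /matrixP/(_ k l); rewrite !mxE.
(* [kron Z 1 = (kron Z 1 X Y') (kron Y 1) L(p)], and [kron Z 1] has a right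
   inverse: the identity of size [r'] factors through size [r]. *)
have r'r : (r' <= r)%N.
  have nZ : null_source Z by apply/ZP.
  apply: (@bmulmx1_min _ _ _ (kron Z 1 *m X *m kron Y' 1)
                 (kron Y 1 *m pev (pcoef P) p *m kron Z' 1)) => //.
  rewrite !mulmxA -sliceY // -(mulmxA _ X) (bmulmx1C LX) mulmx1.
  by rewrite -kronM ZZ' mulr1 kron1.
have /choice[M YL] : forall k, exists Mk : 'M_(r, r'), Y *m pcoef P k = Mk *m Z.
  by move=> k; apply/submxP/ZP/null_target_coef; split.
have rr' : (r <= r')%N.
  apply: (@bmulmx1_min _ _ _ (pev M p) (kron Z 1 *m X *m kron Y' 1)) => //.
  rewrite !mulmxA -pevMr; under eq_fun do rewrite -YL.
  by rewrite pevMl -(mulmxA _ _ X) LX mulmx1 -kronM YY' mulr1 kron1.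
have r_gt0 : (0 < r)%N.
  rewrite lt0n; apply: contra_neq phi0 => r0.
  have : phi *m X = 0 by rewrite sliceY // -mulmxA; subst r; rewrite [Y]flatmx0 kron0 !mulmx0.
  by move/(congr1 (mulmx^~ (pev (pcoef P) p))); rewrite mul0mx -mulmxA (bmulmx1C LX) mulmx1.
have {r'r rr'} e : r' = r by apply/eqP; rewrite eqn_leq r'r.
subst r'; have [Q QP Qdim] := refines_block Yfree Zfree YL nYb.
exists Q => //; rewrite Qdim ltn_subrL r_gt0 /=.
by rewrite (leq_trans r_gt0) // -(eqP Yfree) rank_leq_col.
Qed.

End Reduction.

(** * Minimal pencils *)

Section BlockTranspose.
Variables (F : fieldType) (s : nat).

(** Transposition of the flattened matrix; transposing the blocks as well makes
    it reverse products. *)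
Definition btr n1 n2 (A : 'M['M[F]_s]_(n1, n2)) : 'M['M[F]_s]_(n2, n1) :=
  \matrix_(i, j) (A j i)^T.

Lemma btrK n1 n2 : cancel (@btr n1 n2) (@btr n2 n1).
Proof. by move=> A; apply/matrixP => i j; rewrite !mxE trmxK. Qed.

Lemma btrM n1 n2 n3 (A : 'M['M[F]_s]_(n1, n2)) (B : 'M_(n2, n3)) :
  btr (A *m B) = btr B *m btr A.
Proof.
apply/matrixP => i j; rewrite mxE [in LHS]mxE [RHS]mxE raddf_sum.
by apply: eq_bigr => k _; rewrite -mulmxE /= trmx_mul ![btr _ _ _]mxE.
Qed.

Lemma btr_is_additive n1 n2 : zmod_morphism (@btr n1 n2).
Proof. by move=> A B; apply/matrixP => k l; rewrite !mxE raddfB. Qed.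

HB.instance Definition _ n1 n2 :=
  GRing.isZmodMorphism.Build _ _ (@btr n1 n2) (@btr_is_additive n1 n2).

Lemma btrN n1 n2 (A : 'M['M[F]_s]_(n1, n2)) : btr (- A) = - btr A.
Proof. exact: raddfN. Qed.

Lemma btr_scalar n (x : 'M[F]_s) : btr (x%:M : 'M_n) = (x^T)%:M.
Proof.
by apply/matrixP => i j; rewrite !mxE eq_sym; case: eqP; rewrite ?mulr1n ?mulr0n ?trmx0.
Qed.

Lemma btr1 n : btr (1%:M : 'M_n) = 1%:M.
Proof. by rewrite btr_scalar trmx1. Qed.

Lemma btr_kron n1 n2 (A : 'M[F]_(n1, n2)) (x : 'M[F]_s) :
  btr (kron A x) = kron A^T x^T.
Proof. by apply/matrixP => i j; rewrite !mxE linearZ. Qed.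

End BlockTranspose.

Section TransposedPencil.
Variables (F : fieldType) (g : nat).

Definition tr_pencil (P : pencil F g) : pencil F g :=
  Pencil (fun k => (pcoef P k)^T) (pin P)^T (pout P)^T.

Lemma pev_tr n1 n2 (L : option 'I_g -> 'M[F]_(n1, n2)) s (a : 'I_g -> 'M[F]_s) :
  pev (fun k => (L k)^T) (fun i => (a i)^T) = btr (pev L a).
Proof.
rewrite /pev raddf_sum; apply: eq_bigr => -[i|] _ /=; rewrite btr_kron //.
by rewrite /= trmx1.
Qed.

Lemma value_at_tr (P : pencil F g) s (a : 'I_g -> 'M[F]_s) x :
  value_at P a x -> value_at (tr_pencil P) (fun i => (a i)^T) x^T.
Proof.
move=> [B LB Bx]; exists (btr B).
  by rewrite pev_tr -btrM (bmulmx1C LB) btr1.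
have -> : (1 : 'M[F]_s) = 1^T by rewrite trmx1.
by rewrite /= -!btr_kron -!btrM mulmxA Bx btr_scalar.
Qed.

Lemma refines_tr (P Q : pencil F g) :
  refines Q (tr_pencil P) -> refines (tr_pencil Q) P.
Proof.
move=> QP s a x /value_at_tr/QP/value_at_tr.
by rewrite trmxK; under eq_fun do rewrite trmxK.
Qed.

End TransposedPencil.

Section Spanning.
Variable F : fieldType.

Lemma sum_col_mx (J : Type) (r : seq J) n1 n2 D (A : J -> 'M[F]_(n1, D))
    (B : J -> 'M[F]_(n2, D)) :
  \sum_(j <- r) col_mx (A j) (B j) =
  col_mx (\sum_(j <- r) A j) (\sum_(j <- r) B j).
Proof.
elim: r => [|j r IHr]; first by rewrite !big_nil col_mx0.
by rewrite !big_cons IHr add_col_mx.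
Qed.

(** Finitely many of the [R i] already have trivial common kernel; the
    coefficients of a left inverse of the matrix stacking them give the
    combination. *)
Lemma one_combination (I : Type) k D (R : I -> 'M[F]_(k, D)) :
  (forall chi : 'M_D, (forall i, R i *m chi = 0) -> chi = 0) ->
  exists ps : seq (I * 'M_(D, k)), \sum_(p <- ps) p.2 *m R p.1 = 1%:M.
Proof.
move=> Rnull.
pose Pr n (V : 'M_(n, D)) :=
  exists ps : seq (I * 'M_(n, k)), \sum_(p <- ps) p.2 *m R p.1 = V.
have [|||r [Y [Yfree YP]]] := @row_space_ex F D Pr.
- by exists [::]; rewrite big_nil.
- move=> n1 n2 A V [ps <-]; exists [seq (p.1, A *m p.2) | p <- ps].
  by rewrite big_map mulmx_sumr; apply: eq_bigr => p _; rewrite mulmxA.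
- move=> n1 n2 V W [ps <-] [qs <-].
  exists ([seq (p.1, col_mx p.2 0) | p <- ps] ++ [seq (q.1, col_mx 0 q.2) | q <- qs]).
  rewrite big_cat !big_map /=.
  under eq_bigr do rewrite mul_col_mx mul0mx.
  under [X in _ + X]eq_bigr do rewrite mul_col_mx mul0mx.
  by rewrite !sum_col_mx !big1_eq add_col_mx addr0 add0r.
have : cokermx Y = 0.
  apply: Rnull => i; have /submxP[A ->] : (R i <= Y)%MS.
    by apply/YP; exists [:: (i, 1%:M)]; rewrite big_seq1 mul1mx.
  by rewrite -mulmxA mulmx_coker mulmx0.
move/eqP; rewrite cokermx_eq0 => Yfull.
by apply/YP; rewrite submx_full.
Qed.

Lemma one_combination_col (I : Type) k D (R : I -> 'M[F]_(D, k)) :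
  (forall phi : 'M_D, (forall i, phi *m R i = 0) -> phi = 0) ->
  exists ps : seq (I * 'M_(k, D)), \sum_(p <- ps) R p.1 *m p.2 = 1%:M.
Proof.
move=> Rnull; have [|ps psP] := @one_combination I k D (fun i => (R i)^T).
  move=> chi chi0; apply: trmx_inj; rewrite trmx0; apply: Rnull => i.
  by rewrite -[R i]trmxK -trmx_mul chi0 trmx0.
exists [seq (p.1, p.2^T) | p <- ps]; rewrite big_map -[RHS]trmx1 -psP raddf_sum.
by apply: eq_bigr => p _; rewrite /= trmx_mul trmxK.
Qed.

End Spanning.

Section Minimal.
Variables (F : fieldType) (g : nat).

Definition minimal_pencil (P : pencil F g) (e : ratexpr F g) : Prop :=
  represents P e /\ forall Q, represents Q e -> (pdim P <= pdim Q)%N.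

Lemma minimal_pencil_ex P e : represents P e ->
  exists Q, minimal_pencil Q e.
Proof.
move=> rP; pose D k := `[< exists2 Q, represents Q e & pdim Q = k >].
have DP : exists k, D k by exists (pdim P); apply/asboolP; exists P.
case: (ex_minnP DP) => k /asboolP[Q rQ Qk] kmin.
by exists Q; split=> // R rR; rewrite Qk; apply: kmin; apply/asboolP; exists R.
Qed.

Section Point.
Variables (s : nat) (P : pencil F g) (p : 'I_g -> 'M[F]_s).
Variable X : 'M['M[F]_s]_(pdim P).
Hypothesis LX : pev (pcoef P) p *m X = 1%:M.

Lemma pword_cat v w :
  pword P X (v ++ w) = pword P X v *m pev (pcoef P) p *m pword P X w.
Proof.
elim: v => [|x v IHv] /=; first by rewrite (bmulmx1C LX) mul1mx.
by rewrite IHv !mulNmx !mulmxA.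
Qed.

Lemma pword_rcons w x :
  pword P X (rcons w x) = - (pword P X w *m letter_coef P x *m X).
Proof.
rewrite -cats1 pword_cat /= mulmxN; congr (- _).
by rewrite -!mulmxA (mulmxA (pev _ _)) LX mul1mx.
Qed.

Lemma btr_letter_coef k (i j : 'I_s) :
  btr (letter_coef P (k, (j, i))) = letter_coef (tr_pencil P) (k, (i, j)).
Proof. by rewrite /letter_coef /= btr_kron trmx_delta. Qed.

Lemma pword_tr w :
  exists w', pword (tr_pencil P) (btr X) w = btr (pword P X w').
Proof.
elim: w => [|[k [i j]] w [w' IHw]] /=; first by exists [::].
exists (rcons w' (k, (j, i))); rewrite IHw pword_rcons btrN !btrM mulmxA.
by rewrite btr_letter_coef.
Qed.

Hypothesis s_gt0 : (0 < s)%N.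
Variable e : ratexpr F g.
Hypothesis minP : minimal_pencil P e.

Lemma refines_minimal Q : refines Q P -> (pdim P <= pdim Q)%N.
Proof. by move=> QP; case: minP => rP; apply => s' a /rP/QP. Qed.

Lemma minimal_reachable n (phi : 'M['M[F]_s]_(n, pdim P)) :
  (forall w, phi *m pword P X w *m kron (pin P) 1 = 0) -> phi = 0.
Proof.
move=> nphi; apply/eqP; apply: contrapT => /negP phi0.
have [Q /refines_minimal] := pencil_reduce s_gt0 LX nphi phi0.
by rewrite leqNgt => /negPf->.
Qed.

(** Apply the reduction to the transposed pencil at the transposed point. *)
Lemma minimal_observable n (chi : 'M['M[F]_s]_(pdim P, n)) :
  (forall w, kron (pout P) 1 *m pword P X w *m chi = 0) -> chi = 0.
Proof.
move=> nchi; apply/eqP; apply: contrapT => /negP chi0.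
have LXt : pev (pcoef (tr_pencil P)) (fun i => (p i)^T) *m btr X = 1%:M.
  by rewrite pev_tr -btrM (bmulmx1C LX) btr1.
have [||Q /refines_tr/refines_minimal] := @pencil_reduce _ _ _ (tr_pencil P) _ _ s_gt0 LXt n (btr chi).
- move=> w; have [w' ->] := pword_tr w.
  have -> : (1 : 'M[F]_s) = 1^T by rewrite trmx1.
  by rewrite -btr_kron -!btrM mulmxA nchi raddf0.
- by apply: contra_neq chi0 => /(congr1 (@btr F s _ _)); rewrite btrK raddf0.
by rewrite leqNgt => /negPf->.
Qed.

(** The rows [c G(v)] and the columns [G(w) b] span everything, so [L(p)] is a
    combination [\sum_v \sum_w A_v (c G(v)) L(p) (G(w) b) B_w].  The middle part
    is the coefficient at [v ++ w], so the invertible matrix [L(p)] of size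
    [D s] factors through size [n s]. *)
Lemma minimal_pencil_le n Pf (Qf : _ -> 'M['M[F]_s]_(n, 1)) :
  (forall v w, kron (pout P) 1 *m pword P X (v ++ w) *m kron (pin P) 1 =
     Pf v *m Qf w) ->
  (pdim P <= n)%N.
Proof.
move=> PQ; rewrite -(leq_pmul2r s_gt0).
have [|vs vsP] := @one_combination _ _ _ _ (fun w => flat (kron (pout P) 1 *m pword P X w)).
  move=> chi chi0; rewrite -[chi]unflatK (minimal_observable (chi := unflat chi)) ?raddf0 //.
  move=> w; apply: (can_inj (@flatK F s _ _)).
  by rewrite flatM unflatK chi0 raddf0.
have [|ws wsP] := @one_combination_col _ _ _ _ (fun w => flat (pword P X w *m kron (pin P) 1)).
  move=> chi chi0; rewrite -[chi]unflatK (minimal_reachable (phi := unflat chi)) ?raddf0 //.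
  move=> w; apply: (can_inj (@flatK F s _ _)).
  by rewrite -mulmxA flatM unflatK chi0 raddf0.
apply: (@mulmx1_min _ _ _ (\sum_(v <- vs) v.2 *m flat (Pf v.1))
   ((\sum_(w <- ws) flat (Qf w.1) *m w.2) *m flat X)).
rewrite mulmxA.
have -> : (\sum_(v <- vs) v.2 *m flat (Pf v.1)) *m (\sum_(w <- ws) flat (Qf w.1) *m w.2)
    = flat (pev (pcoef P) p).
  rewrite -[RHS]mul1mx -vsP -[RHS]mulmx1 -wsP !mulmx_suml.
  apply: eq_bigr => v _; rewrite !mulmx_sumr; apply: eq_bigr => w _.
  rewrite -!mulmxA; congr (_ *m _); rewrite !mulmxA -!flatM -PQ pword_cat.
  by rewrite !mulmxA.
by rewrite -flatM LX flat1.
Qed.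

End Point.
End Minimal.

(** * Expansions *)

Section Staircase.
Variables (R : pzRingType) (L : Type) (u : seq L).
Implicit Types S T : ncps R L.

(** The contiguous factor of [u] between the positions [i] and [j]. *)
Definition factor i j : seq L := take (j - i) (drop i u).

Definition staircase S : 'M[R]_((size u).+1) :=
  \matrix_(i, j) if (i <= j)%N then S (factor i j) else 0.

Lemma staircase_corner S : staircase S ord0 ord_max = S u.
Proof. by rewrite mxE /= /factor drop0 subn0 take_size. Qed.

Lemma staircase_const a : staircase (ncps_const a) = a%:M.
Proof.
apply/matrixP => i j; rewrite !mxE; case: (ltngtP i j) => [ij|ij|/val_inj->].
- rewrite (_ : i == j = false); last by apply/eqP => eij; rewrite eij ltnn in ij.
  have : (0 < size (factor i j))%N.
    rewrite /factor size_takel ?subn_gt0 // size_drop.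
    by rewrite leq_sub2r // -ltnS.
  by case: (factor i j).
- by rewrite (_ : i == j = false) //; apply/eqP => eij; rewrite eij ltnn in ij.
- by rewrite eqxx /factor subnn take0.
Qed.

Lemma staircase_is_zmod_morphism : zmod_morphism staircase.
Proof.
by move=> S T; apply/matrixP => i j; rewrite !mxE; case: ifP; rewrite ?subr0.
Qed.

(** The ways of cutting the factor of [u] from [i] to [j] in two are the
    positions [k] with [i <= k <= j]. *)
Lemma staircase_is_monoid_morphism : monoid_morphism staircase.
Proof.
split=> [|S T]; first exact: staircase_const.
apply/matrixP => i j; rewrite !mxE.
under eq_bigr do rewrite !mxE.
case: leqP => [ij|ji]; last first.
  rewrite big1 // => k _; case: leqP => [ik|]; last by rewrite mul0r.
  by case: leqP; rewrite ?mulr0 // => kj; have := leq_trans ik kj; rewrite leqNgt ji.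
pose f k := (if (i <= k)%N then S (factor i k) else 0) *
            (if (k <= j)%N then T (factor k j) else 0).
rewrite -[RHS](big_mkord xpredT f).
rewrite (big_cat_nat (n := j.+1)) //= [X in _ + X]big_nat_cond.
rewrite [X in _ + X]big1 ?addr0; last first.
  by move=> k /andP[/andP[jk _] _]; rewrite /f [(k <= j)%N]leqNgt jk mulr0.
rewrite (big_cat_nat (n := i)) //= ?leqW // [X in X + _]big_nat_cond big1 ?add0r; last first.
  by move=> k /andP[/andP[_ ki] _]; rewrite /f leqNgt ki mul0r.
have szf : size (factor i j) = (j - i)%N.
  by rewrite /factor size_takel // size_drop leq_sub2r // -ltnS.
rewrite -[X in index_iota X _]add0n.
rewrite big_addn subSn // big_mkord ncpsME szf.
apply: eq_bigr => k _; rewrite /f leq_addl.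
have kij : (k + i <= j)%N by rewrite addnC -leq_subRL // -ltnS.
rewrite kij /factor addnK take_takel; last by rewrite -ltnS.
by congr (_ * T _); rewrite !take_drop drop_drop !subnK.
Qed.

HB.instance Definition _ := GRing.isZmodMorphism.Build _ _ staircase
  staircase_is_zmod_morphism.
HB.instance Definition _ := GRing.isMonoidMorphism.Build _ _ staircase
  staircase_is_monoid_morphism.

End Staircase.

Section Expansion.
Variables (F : fieldType) (g s : nat).

(** The point [x + p]. *)
Definition shifted (p : 'I_g -> 'M[F]_s) (k : 'I_g) : mxps F s g :=
  mxps_const (p k) + mxps_var F k.

(** The expansion of [e] about [p] is its value at [x + p]; a ring morphism to
    scalar matrices maps it to the value of [e] at the image of [x + p]. *)
Lemma expansion_morph n (h : {rmorphism mxps F s g -> 'M[F]_n}) p e :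
  (forall t, h (mxps_const t%:M) = t%:M) ->
  rdom p e -> rdom (fun k => h (shifted p k)) e /\
  rev_at (fun k => h (shifted p k)) e = h (expansion p e) :> 'M[F]_n.
Proof.
move=> hC; elim: e => [t|j|e1 IH1 e2 IH2|e1 IH1 e2 IH2|e IH] //=.
- by move=> /andP[/IH1[-> ->] /IH2[-> ->]]; rewrite rmorphD.
- by move=> /andP[/IH1[-> ->] /IH2[-> ->]]; rewrite rmorphM.
move=> /andP[/IH[-> ->]]; rewrite -expansion_nil => /mxps_inv_spec[_ hinv].
apply: invmx_eq; rewrite mulmxE -rmorphM hinv rmorph1 //.
Qed.

Definition stair_morph (u : seq ('I_g * ('I_s * 'I_s))) :
  mxps F s g -> 'M[F]_((size u).+1 * s) := @flat F s (size u).+1 (size u).+1 \o @staircase _ _ u.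

HB.instance Definition _ u := GRing.RMorphism.on (stair_morph u).

Lemma stair_morph_const u t : stair_morph u (mxps_const t%:M) = t%:M.
Proof. by rewrite /stair_morph /= [staircase _ _]staircase_const; exact: flat_scalar. Qed.

Lemma stair_morph_inj u S T : stair_morph u S = stair_morph u T -> S u = T u.
Proof.
by move=> /(can_inj (@flatK F s _ _)) eST; rewrite -!(staircase_corner u) eST.
Qed.

End Expansion.

Lemma ncpsM_const (R : pzRingType) (L : Type) (S : ncps R L) b u :
  (S * ncps_const b) u = S u * b.
Proof.
rewrite ncpsME big_ord_recr /= drop_size take_size big1 ?add0r // => i _.
have : (0 < size (drop i u))%N by rewrite size_drop subn_gt0.
by case: (drop i u) => // x v _; rewrite mulr0.
Qed.

Section ExpansionPencil.
Variables (F : fieldType) (g s : nat) (P : pencil F g) (p : 'I_g -> 'M[F]_s).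
Variable X : 'M['M[F]_s]_(pdim P).
Hypothesis LX : pev (pcoef P) p *m X = 1%:M.

(** The pencil at the point [x + p]. *)
Definition series_pencil : 'M[mxps F s g]_(pdim P) :=
  \matrix_(i, j) (@mxps_const F s g (pcoef P None i j)%:M +
    \sum_k mxps_const (pcoef P (Some k) i j)%:M * shifted p k).

Definition series_inverse : 'M[mxps F s g]_(pdim P) :=
  \matrix_(i, j) (fun w => pword P X w i j).

Lemma series_pencil_nil i j : series_pencil i j [::] = pev (pcoef P) p i j.
Proof.
rewrite mxE ncpsDE ncps_sumE /pev sum_option !mxE summxE scalemx1.
congr (_ + _); apply: eq_bigr => k _.
by rewrite ncps_constM /shifted ncpsDE addr0 /= mxE -mulmxE mul_scalar_mx.
Qed.

Lemma series_pencil_letter i j x : series_pencil i j [:: x] = letter_coef P x i j.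
Proof.
case: x => k [i' j']; rewrite mxE ncpsDE ncps_sumE add0r (bigD1 k) //= big1.
  by rewrite addr0 ncps_constM /shifted ncpsDE add0r /= eqxx mxE -mulmxE mul_scalar_mx.
move=> k' /negPf kk'; rewrite ncps_constM /shifted ncpsDE add0r /= eq_sym kk'.
by rewrite mulr0.
Qed.

Lemma series_pencil_long i j x y w : series_pencil i j [:: x, y & w] = 0.
Proof.
rewrite mxE ncpsDE ncps_sumE add0r big1 // => k _.
by rewrite ncps_constM /shifted ncpsDE add0r /=; case: x => ? [? ?]; rewrite mulr0.
Qed.

Lemma series_pencilV : series_pencil *m series_inverse = 1%:M.
Proof.
apply/matrixP => i j; rewrite [LHS]mxE; apply/funext => -[|x w].
  rewrite ncps_sumE.
  under eq_bigr do rewrite ncpsM_nil series_pencil_nil [series_inverse _ _]mxE.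
  by have /matrixP/(_ i j) := LX; rewrite !mxE => ->; case: eqP.
rewrite ncps_sumE.
under eq_bigr => k _.
  rewrite ncpsME !big_ord_recl /= big1 ?addr0 => [|l _]; last first.
    case: w l => [|y w] [l lw] //.
    by rewrite [take _ _]/= series_pencil_long mul0r.
  rewrite series_pencil_nil take0 drop0 series_pencil_letter ![series_inverse _ _]mxE.
  over.
rewrite big_split /=.
have LXw : pev (pcoef P) p *m pword P X (x :: w) + letter_coef P x *m pword P X w = 0.
  by rewrite /= mulmxN !mulmxA LX mul1mx addNr.
move/matrixP: LXw => /(_ i j); rewrite [LHS]mxE ![in LHS](@mxE _ _ _ mulmx_key).
move=> ->; rewrite !mxE; case: eqP => _; rewrite ?mulr1n ?mulr0n //.
Qed.

(** A minimal pencil is only known to compute [e] at matrices over [F], so the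
    coefficient at [u] is read off in the image of [x + p] under the staircase
    morphism of [u]. *)
Lemma expansion_pencil e u : represents P e -> rdom p e ->
  (expansion p e u)%:M = kron (pout P) 1 *m pword P X u *m kron (pin P) 1.
Proof.
move=> rP pe; pose h : {rmorphism mxps F s g -> 'M[F]_((size u).+1 * s)} := @stair_morph F g s u.
have [ae ev] := expansion_morph (stair_morph_const u) pe.
have [B LB Bv] := rP _ _ ae; rewrite ev in Bv.
pose constF (t : F) : mxps F s g := mxps_const t%:M.
pose T := (map_mx constF (pout P) *m series_inverse *m map_mx constF (pin P)) 0 0.
have kronh n1 n2 (A : 'M[F]_(n1, n2)) : kron A 1 = map_mx h (map_mx constF A).
  by apply/matrixP => i j; rewrite !mxE [RHS]stair_morph_const scalemx1.
have pevh : pev (pcoef P) (fun k => h (shifted p k)) = map_mx h series_pencil.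
  apply/matrixP => i j; rewrite /pev sum_option !mxE summxE rmorphD rmorph_sum.
  rewrite [h (mxps_const _)]stair_morph_const scalemx1; congr (_ + _).
  apply: eq_bigr => k _; rewrite mxE rmorphM.
  by rewrite [h (mxps_const _)]stair_morph_const -mulmxE mul_scalar_mx.
have eB : B = map_mx h series_inverse.
  rewrite -[B]mulmx1 -(map_mx1 h) -series_pencilV map_mxM -pevh mulmxA.
  by rewrite (bmulmx1C LB) mul1mx.
have hT : h (expansion p e) = h T.
  move/matrixP: Bv => /(_ 0 0); rewrite eB !kronh -!map_mxM mxE => ->.
  by rewrite mxE eqxx.
have -> : expansion p e u = T u by exact: stair_morph_inj hT.
apply/matrixP => i j; rewrite !ord1 mxE eqxx mulr1n /T mxE ncps_sumE [RHS]mxE.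
apply: eq_bigr => k _; rewrite [map_mx _ _ _ _]mxE ncpsM_const.
rewrite [kron _ _ _ _]mxE scalemx1; congr (_ * _).
rewrite mxE ncps_sumE [RHS]mxE; apply: eq_bigr => l _.
by rewrite [map_mx _ _ _ _]mxE ncps_constM [kron _ _ _ _]mxE scalemx1 [series_inverse _ _]mxE.
Qed.

End ExpansionPencil.

(** * The pencil degree of a rational function *)

Section PencilDegree.
Variables (F : fieldType) (g : nat).
Hypothesis char0 : [pchar F] =i pred0.
Implicit Types e : ratexpr F g.

(** The least size of a pencil plays the role of the Sylvester degree; it does
    not refer to a point. *)
Definition pencil_degree_le e n : Prop :=
  exists2 P, represents P e & (pdim P <= n)%N.

Lemma pencil_degree_factor s (q : 'I_g -> 'M[F]_s) e n Pf
    (Qf : seq ('I_g * ('I_s * 'I_s)) -> 'M['M[F]_s]_(n, 1)) :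
  (0 < s)%N -> rdom q e ->
  (forall v w, (expansion q e (v ++ w))%:M = Pf v *m Qf w) ->
  pencil_degree_le e n.
Proof.
move=> s_gt0 qe ePQ; have [P0 [rP0 _]] := linearization e.
have [P minP] := minimal_pencil_ex rP0; exists P; first by case: minP.
have [B LB _] := minP.1 _ _ qe.
apply: (minimal_pencil_le LB s_gt0 minP (Pf := Pf) (Qf := Qf)) => v w.
by rewrite -(expansion_pencil LB _ minP.1).
Qed.

Lemma expansion_factor P s (q : 'I_g -> 'M[F]_s) e : represents P e -> rdom q e ->
  exists Pf, exists Qf : _ -> 'M['M[F]_s]_(pdim P, 1), forall v w,
    (expansion q e (v ++ w))%:M = Pf v *m Qf w.
Proof.
move=> rP qe; have [B LB _] := rP _ _ qe.
exists (fun v => kron (pout P) 1 *m pword P B v *m pev (pcoef P) q).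
exists (fun w => pword P B w *m kron (pin P) 1) => v w.
by rewrite (expansion_pencil LB) // (pword_cat LB) !mulmxA.
Qed.

(** The third expression only restricts the points of comparison.  Two
    representatives of a function are compared with a third one that defines
    their class, and a common point of their domains may lie outside the domain
    of the third. *)
Definition agree_on e1 e2 (T : ratexpr F g) : Prop :=
  forall s (a : 'I_g -> 'M[F]_s), (0 < s)%N ->
    rdom a e1 -> rdom a e2 -> rdom a T -> rev_at a e1 = rev_at a e2.

(** The coefficients of the expansions are corners of values at the staircase
    points, which lie in the same domains as [q]. *)
Lemma expansion_agree e1 e2 T s (q : 'I_g -> 'M[F]_s) u : (0 < s)%N ->
  agree_on e1 e2 T -> rdom q e1 -> rdom q e2 -> rdom q T ->
  expansion q e1 u = expansion q e2 u.
Proof.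
move=> s_gt0 e12 q1 q2 qT; apply: stair_morph_inj.
have [d1 v1] := expansion_morph (stair_morph_const u) q1.
have [d2 v2] := expansion_morph (stair_morph_const u) q2.
have [dT _] := expansion_morph (stair_morph_const u) qT.
by rewrite [LHS](esym v1) [RHS](esym v2); apply: e12; rewrite // muln_gt0.
Qed.

Lemma pencil_degree_agree e1 e2 T n : nondegenerate e1 -> nondegenerate e2 ->
  nondegenerate T -> agree_on e1 e2 T ->
  pencil_degree_le e2 n -> pencil_degree_le e1 n.
Proof.
move=> n1 n2 nT e12 [P rP Pn].
have [s [q [s_gt0 /andP[/andP[q1 q2] qT]]]] :=
  nondegenerateD char0 (nondegenerateD char0 n1 n2) nT.
have [Pf [Qf PQ]] := expansion_factor rP q2.
have [|Q rQ Qn] := pencil_degree_factor s_gt0 q1 (n := pdim P) (Pf := Pf) (Qf := Qf).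
  by move=> v w; rewrite (expansion_agree _ s_gt0 e12).
by exists Q; rewrite // (leq_trans Qn).
Qed.

Lemma pencil_degree0 e s (a : 'I_g -> 'M[F]_s) :
  pencil_degree_le e 0 -> rdom a e -> rev_at a e = 0.
Proof.
move=> [P rP P0] /rP[B _].
have -> : kron (pout P) (1 : 'M[F]_s) = 0.
  by apply/matrixP => i [j jP]; have := leq_trans jP P0; rewrite ltn0.
rewrite !mul0mx => /matrixP/(_ 0 0).
by rewrite !mxE mulr1n => <-.
Qed.

Lemma expansion0_degree e s (q : 'I_g -> 'M[F]_s) : (0 < s)%N -> rdom q e ->
  (forall u, expansion q e u = 0) -> pencil_degree_le e 0.
Proof.
move=> s_gt0 qe e0; apply: (pencil_degree_factor s_gt0 qe (Pf := fun=> 0) (Qf := fun=> 0)).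
by move=> v w; rewrite e0 mulmx0 raddf0.
Qed.

Lemma degree0_const0 : pencil_degree_le (RConst g (0 : F)) 0.
Proof.
by apply: (@expansion0_degree _ 1 (fun=> 0)) => // -[|x u] //=; rewrite /mxps_const /= raddf0.
Qed.

(** The difference of [e1] and [e2] vanishes wherever the representative [r]
    that defines the class is also defined, so its pencil degree is [0], and it
    vanishes on its whole domain. *)
Lemma ncrat_equiv (f : ncrat F g) e1 e2 : f e1 -> f e2 ->
  [/\ nondegenerate e1, nondegenerate e2 & ratequiv e1 e2].
Proof.
case: f => C [r nr CP] /= /CP[n1 r1] /CP[n2 r2]; split=> // s a s_gt0 a1 a2.
pose d := RAdd e1 (RMul (RConst g (-1)) e2).
have nd : nondegenerate d by exists s, a; rewrite /= a1 a2.
have d0 : agree_on d (RConst g 0) r.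
  move=> s' b s'_gt0 /= /andP[b1 b2] _ br.
  by rewrite -(r1 _ _ s'_gt0 br b1) -(r2 _ _ s'_gt0 br b2) mul_scalar_mx scaleN1r subrr raddf0.
have : rev_at a d = 0.
  apply: (pencil_degree0 (pencil_degree_agree nd (nondegenerate_const g 0) nr d0 degree0_const0)).
  by rewrite /= a1 a2.
by rewrite /= mul_scalar_mx scaleN1r => /eqP; rewrite subr_eq0 => /eqP.
Qed.

End PencilDegree.

Section RealizationDegree.
Variables (F : fieldType) (g m n : nat).
Variables (p : 'I_g -> 'M[F]_m) (f : ncrat F g).
Variables (c : 'M['M[F]_m]_(1, n)) (A : 'I_g -> 'M[mxps F m g]_n)
  (b : 'M['M[F]_m]_(n, 1)).
Hypothesis fP : realization p f c A b.

(** [A] reduced to matrices over ['M_m]: each [A k] is supported on words of one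
    letter and is thus given by its coefficients there. *)
Definition realization_word (u : seq ('I_g * ('I_m * 'I_m))) : 'M['M[F]_m]_n :=
  foldr (fun x B => (\matrix_(i, j) A x.1 i j [:: x]) *m B) 1%:M u.

Lemma realization_word_cat v w :
  realization_word (v ++ w) = realization_word v *m realization_word w.
Proof. by elim: v => [|x v IHv] /=; rewrite ?mul1mx // IHv mulmxA. Qed.

Lemma Apow_coef u i j : Apow A (unzip1 u) i j u = realization_word u i j.
Proof.
have [_ _ hA _] := fP.
have A0 k i' j' v : unzip1 v != [:: k] -> A k i' j' v = 0.
  by move: v; apply/in_AwP/hA.
elim: u i j => [|x u IHu] i j /=; first by rewrite !mxE; case: eqP.
rewrite mxE ncps_sumE mxE; apply: eq_bigr => k _.
rewrite ncpsME big_ord_recl take0 A0 // mul0r add0r big_ord_recl big1 => [|l _].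
  by rewrite addr0 /= take0 drop0 IHu mxE.
rewrite A0 ?mul0r //=.
by case: u l {IHu} => [|y u] [l lu] //=; rewrite eqseq_cons /= andbF.
Qed.

Lemma realization_degree e : f e -> rdom p e -> pencil_degree_le e n.
Proof.
move=> fe pe; have [m_gt0 _ _ fA] := fP.
apply: (pencil_degree_factor m_gt0 pe
  (Pf := fun v => c *m realization_word v) (Qf := fun w => realization_word w *m b)).
move=> v w; rewrite mulmxA -(mulmxA c) -realization_word_cat.
move: (v ++ w) => u {v w}.
have := congr1 (fun T : mxps F m g => T u) (fA _ fe pe (unzip1 u)).
rewrite /mxps_coef eqxx => ->; apply/matrixP => i j; rewrite !ord1.
rewrite mxE eqxx mulr1n mxE ncps_sumE [RHS]mxE; apply: eq_bigr => k _.
rewrite [map_mx _ _ _ _]mxE ncpsM_const; congr (_ * _).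
rewrite mxE ncps_sumE [RHS]mxE; apply: eq_bigr => l _.
by rewrite [map_mx _ _ _ _]mxE ncps_constM Apow_coef.
Qed.

End RealizationDegree.

(** * Points where a combination does not vanish *)

Section Combination.
Variables (F : fieldType) (g l : nat).
Implicit Types (c : 'I_l -> F) (e : 'I_l -> ratexpr F g).

Definition lincomb c e : ratexpr F g :=
  \big[@RAdd F g/RConst g 0]_(j < l) RMul (RConst g (c j)) (e j).

Lemma lincombP c e s (a : 'I_g -> 'M[F]_s) :
  (forall j, rdom a (e j)) ->
  rdom a (lincomb c e) /\ rev_at a (lincomb c e) = \sum_j c j *: rev_at a (e j).
Proof.
move=> ae; rewrite /lincomb; elim: (index_enum _) => [|j r [IHd IHv]].
  by rewrite !big_nil /= raddf0.
by rewrite !big_cons /= ae IHd IHv mul_scalar_mx.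
Qed.

Lemma rdom_lincomb c e s (a : 'I_g -> 'M[F]_s) :
  rdom a (lincomb c e) -> forall j, rdom a (e j).
Proof.
move=> ac j; move: ac; rewrite /lincomb.
have: j \in index_enum 'I_l by exact: mem_index_enum.
elim: (index_enum _) => // k r IHr; rewrite inE big_cons /=.
by case/predU1P => [->|/IHr jr] /andP[].
Qed.

Lemma expansion_lincomb c e s (p : 'I_g -> 'M[F]_s) u :
  expansion p (lincomb c e) u = \sum_j c j *: expansion p (e j) u.
Proof.
rewrite /lincomb; elim: (index_enum _) => [|j r IHr].
  by rewrite !big_nil /=; case: u => [|x u] //=; rewrite raddf0.
by rewrite !big_cons /= ncpsDE IHr ncps_constM -mulmxE mul_scalar_mx.
Qed.

Lemma nondegenerate_lincomb c e : [pchar F] =i pred0 ->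
  (forall j, nondegenerate (e j)) -> nondegenerate (lincomb c e).
Proof.
move=> char0 ne; rewrite /lincomb; elim/big_ind: _ => [||j _].
- exact: nondegenerate_const.
- exact: nondegenerateD.
by have [s [a [s_gt0 ae]]] := ne j; exists s, a; rewrite /= ae.
Qed.

Lemma common_point e m : [pchar F] =i pred0 ->
  (forall j, exists p : 'I_g -> 'M[F]_m, rdom p (e j)) ->
  exists p : 'I_g -> 'M[F]_m, forall j, rdom p (e j).
Proof.
move=> char0 pe.
have [p pd] : exists p : 'I_g -> 'M[F]_m, rdom p (lincomb (fun=> 0) e).
  rewrite /lincomb; elim/big_ind: _ => [|x y [a ax] [b bx]|j _].
  - by exists (fun=> 0).
  - exact: (rdom_common char0 ax bx).
  - by have [p pj] := pe j; exists p.
by exists p; exact: rdom_lincomb pd.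
Qed.

End Combination.

Section Nonvanishing.
Variables (F : fieldType) (g l d m : nat) (e : 'I_l -> ratexpr F g).
Variable p : 'I_g -> 'M[F]_m.
Hypotheses (pe : forall j, rdom p (e j)) (deg_e : forall j, pencil_degree_le (e j) d).

(** The coefficient at [v ++ w] factors through size [pdim P] over ['M_m]; fixing
    the entry [(i0, j0)] leaves a factorization through size [pdim P * m] over
    [F]. *)
Lemma hankel_rank j u i0 j0 :
  (\rank (\matrix_(i < (size u).+1, k < (size u).+1)
     expansion p (e j) (take i u ++ drop k u) i0 j0) <= d * m)%N.
Proof.
have [P rP Pd] := deg_e j.
have [Pf [Qf PQ]] := expansion_factor rP (pe j).
pose A := \matrix_(i < (size u).+1, k < pdim P * m) flat (Pf (take i u)) (mxvec_index 0 i0) k.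
pose B := \matrix_(k < pdim P * m, i < (size u).+1) flat (Qf (drop i u)) k (mxvec_index 0 j0).
rewrite (_ : \matrix_(i, k) _ = A *m B).
  rewrite (leq_trans (mulmx_max_rank _ _)) //.
  by rewrite leq_mul2r Pd orbT.
apply/matrixP => i k; rewrite !mxE.
transitivity (flat (Pf (take i u) *m Qf (drop k u)) (mxvec_index 0 i0) (mxvec_index 0 j0)).
  by rewrite -PQ flatE mxE eqxx mulr1n.
by rewrite flatM mxE; apply: eq_bigr => h _; rewrite !mxE.
Qed.

(** Let [v] be a shortest word at which the combination [S] is nonzero, and
    [(i0, j0)] a nonzero entry of [S v].  In the Hankel matrix of the splittings
    of [v] the entries above the diagonal come from shorter words, so it is
    triangular and invertible, and [size v + 1] is its rank. *)
Lemma nonvanishing_point k (c : 'I_l -> F) u : (k <= l)%N ->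
  (forall j : 'I_l, (k <= j)%N -> c j = 0) ->
  \sum_j c j *: expansion p (e j) u != 0 ->
  exists2 n, (n <= k * (d * m))%N & exists2 a : 'I_g -> 'M[F]_(n * m),
    forall j, rdom a (e j) & \sum_j c j *: rev_at a (e j) != 0.
Proof.
move=> kl ck u0; pose S v := \sum_j c j *: expansion p (e j) v.
pose Q n := `[< exists2 v, S v != 0 & size v = n >].
have Qu : exists n, Q n by exists (size u); apply/asboolP; exists u.
case: (ex_minnP Qu) => n /asboolP[v v0 vn] vmin {u u0 Qu}.
have S0 w : (size w < size v)%N -> S w = 0.
  move=> wv; apply/eqP; apply: contraLR wv => w0; rewrite -leqNgt vn.
  by apply: vmin; apply/asboolP; exists w.
exists n.+1; last first.
  rewrite -vn; have aP j := expansion_morph (stair_morph_const v) (pe j).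
  exists (fun k => stair_morph v (shifted p k)) => [j|]; first by case: (aP j).
  have [_ eD] := lincombP c (fun j => (aP j).1).
  rewrite -eD; have [|_ ->] := expansion_morph (stair_morph_const v) (p := p) (e := lincomb c e).
    by case: (lincombP c pe).
  apply: contra_neq v0 => v0.
  rewrite /S -expansion_lincomb -[RHS](ncps0E _ v); apply: stair_morph_inj.
  by rewrite v0 rmorph0.
have /existsP[i0 /existsP[j0 vij]] : [exists i, exists j, S v i j != 0].
  apply: contraNT v0 => /existsPn v0; apply/eqP/matrixP => i j.
  by have /existsPn/(_ j) := v0 i; rewrite negbK mxE => /eqP.
pose H j := \matrix_(i < (size v).+1, h < (size v).+1)
  expansion p (e j) (take i v ++ drop h v) i0 j0.
pose T := \sum_j c j *: H j.
have TE i h : T i h = S (take i v ++ drop h v) i0 j0.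
  by rewrite /T /S !summxE; apply: eq_bigr => j _; rewrite !mxE.
have T_trig : is_trig_mx T.
  apply/is_trig_mxP => i h ih; rewrite TE S0 ?mxE // size_cat size_drop size_takel; last by rewrite -ltnS.
  have hv : (h <= size v)%N by rewrite -ltnS.
  by rewrite -[X in (_ < X)%N](subnK hv) addnC ltn_add2l.
have T_unit : T \in unitmx.
  rewrite unitmxE det_trig // unitfE; apply/prodf_neq0 => i _.
  by rewrite TE cat_take_drop.
rewrite -vn -(mxrank_unit T_unit).
have -> : T = \sum_(j < l | (j < k)%N) c j *: H j.
  rewrite /T (bigID (fun j : 'I_l => (j < k)%N)) /= [X in _ + X]big1 ?addr0 // => j.
  by rewrite -leqNgt => /ck->; rewrite scale0r.
apply: (@leq_trans (\sum_(j < l | (j < k)%N) (d * m))%N); last first.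
  by rewrite (big_ord_narrow kl) sum_nat_const card_ord.
apply: (big_ind2 (fun (A : 'M_((size v).+1)) n => (\rank A <= n)%N)) => [|A a B b Aa Bb|j _].
- by rewrite mxrank0.
- by rewrite (leq_trans (mxrank_add _ _)) // leq_add.
- by rewrite (leq_trans (mxrank_scale _ _)) // hankel_rank.
Qed.

End Nonvanishing.

(** * Points where the functions are independent *)

Section Separation.
Variables (F : fieldType) (g l d m : nat) (e : 'I_l -> ratexpr F g).
Variable p : 'I_g -> 'M[F]_m.
Hypotheses (pe : forall j, rdom p (e j)) (deg_e : forall j, pencil_degree_le (e j) d).

Definition separating k s (a : 'I_g -> 'M[F]_s) : Prop :=
  (forall j, rdom a (e j)) /\
  forall c : 'I_l -> F, (forall j : 'I_l, (k <= j)%N -> c j = 0) ->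
    \sum_j c j *: rev_at a (e j) = 0 -> forall j, c j = 0.

Lemma rev_at_dsum s t (a : 'I_g -> 'M[F]_s) (b : 'I_g -> 'M[F]_t) (c : 'I_l -> F) :
  (forall j, rdom a (e j)) -> (forall j, rdom b (e j)) ->
  \sum_j c j *: rev_at (dsum a b) (e j) =
  block_mx (\sum_j c j *: rev_at a (e j)) 0 0 (\sum_j c j *: rev_at b (e j)).
Proof.
move=> ae be.
under eq_bigr => j _ do rewrite (dsumP (ae j) (be j)).2 scale_block_mx !scaler0.
elim: (index_enum _) => [|j r IHr]; first by rewrite !big_nil block_mx0.
by rewrite !big_cons IHr add_block_mx !addr0.
Qed.

(** Direct sums with copies of [p] reach every larger size. *)
Lemma separating_pad k n n' : (n <= n')%N ->
  (exists a : 'I_g -> 'M[F]_(n * m), separating k a) ->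
  exists a : 'I_g -> 'M[F]_(n' * m), separating k a.
Proof.
move=> /subnKC <-; elim: (n' - n)%N => [|i IHi]; first by rewrite addn0.
move=> /IHi[a [ae asep]]; rewrite addnS mulSn; exists (dsum p a); split=> [j|c ck].
  by case: (dsumP (pe j) (ae j)).
rewrite rev_at_dsum // => /(congr1 drsubmx); rewrite block_mxKdr => b0.
by apply: asep ck _; rewrite b0; apply/matrixP => x y; rewrite !mxE.
Qed.

Hypothesis independent : forall c : 'I_l -> F, (exists j, c j != 0) ->
  exists u, \sum_j c j *: expansion p (e j) u != 0.

(** A relation [c] that holds at [a] among the first [k + 1] functions is unique
    up to a scalar, so no relation is left at the direct sum of [a] and a point
    [b] where [c] fails. *)
Lemma separating_step k n : (k < l)%N ->
  (exists a : 'I_g -> 'M[F]_(n * m), separating k a) ->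
  exists a : 'I_g -> 'M[F]_((n + k.+1 * (d * m)) * m), separating k.+1 a.
Proof.
move=> kl [a [ae asep]].
have [sepa|] := pselect (separating k.+1 a).
  by apply: (@separating_pad _ n); [exact: leq_addr | exists a].
move=> /not_andP[//|/existsNP[c /not_implyP[ck /not_implyP[c0 /existsNP[j0 /eqP cj0]]]]].
have [u u0] := independent (ex_intro _ j0 cj0).
have [n' n'le [b be b0]] := nonvanishing_point pe deg_e kl ck u0.
apply: (@separating_pad _ (n + n')); first by rewrite leq_add2l.
rewrite mulnDl; exists (dsum a b); split=> [j|c' c'k].
  by case: (dsumP (ae j) (be j)).
rewrite rev_at_dsum // -[RHS](block_mx0 _ (n * m) (n' * m) (n * m) (n' * m)).
move=> /eq_block_mx[c'a _ _ c'b].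
pose jk := Ordinal kl.
(* [c jk c' - c' jk c] is a relation at [a] among the first [k] functions. *)
have prop j : c jk * c' j = c' jk * c j.
  apply/eqP; rewrite -subr_eq0; apply/eqP; move: j.
  apply: asep => [j|].
    rewrite leq_eqVlt => /predU1P[kj|kj]; last by rewrite (ck j kj) (c'k j kj) !mulr0 subrr.
    by have -> : j = jk by [exact: val_inj]; rewrite mulrC subrr.
  under eq_bigr do rewrite scalerBl -!scalerA.
  by rewrite sumrB -!scaler_sumr c'a c0 !scaler0 subrr.
have cjk : c jk != 0.
  apply: contra_neq cj0 => cjk; move: j0; apply: asep => // j.
  rewrite leq_eqVlt => /predU1P[kj|kj]; last exact: ck.
  by have -> : j = jk by exact: val_inj.
have : c' jk *: (\sum_j c j *: rev_at b (e j)) = 0.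
  rewrite scaler_sumr; under eq_bigr do rewrite scalerA -prop -scalerA.
  by rewrite -scaler_sumr c'b scaler0.
move/eqP; rewrite scaler_eq0 (negPf b0) orbF => /eqP c'jk j.
by have /eqP := prop j; rewrite c'jk mul0r mulf_eq0 (negPf cjk) => /eqP.
Qed.

(** The summand [1] is for the starting point [p], at which nothing has to be
    separated. *)
Lemma separating_ex k : (k <= l)%N ->
  exists a : 'I_g -> 'M[F]_((1 + (\sum_(i < k) i.+1) * (d * m)) * m),
    separating k a.
Proof.
elim: k => [|k IHk] kl.
  rewrite big_ord0 mul0n addn0 mul1n; exists p; split=> // c c0 _ j.
  exact: c0.
rewrite big_ord_recr (mulnDl _ _ (d * m)) addnA; apply: separating_step => //.
exact/IHk/ltnW.
Qed.

End Separation.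

(** [2 (1 + ... + l) = l (l + 1) <= 3 l!], and the term [4] of the bound absorbs
    the summand [1]. *)
Lemma separating_size l d m : (0 < m)%N ->
  (1 + (\sum_(i < l) i.+1) * (d * m) <= uphalf (m * l`! * (3 * d + 4)))%N.
Proof.
move=> m_gt0; have sumE : (2 * \sum_(i < l) i.+1 = l.+1 * l)%N.
  elim: l => [|l IHl]; first by rewrite big_ord0 muln0.
  by rewrite big_ord_recr /= mulnDr IHl [(l.+1 * l)%N]mulnC -mulnDl addn2.
have sum_le : (l.+1 * l <= 3 * l`!)%N.
  case: l {sumE} => [|[|[|l]]] //; elim: l => [|l IHl] //.
  rewrite factS mulnCA; apply: leq_trans (leq_mul (leqnn l.+4) IHl).
  rewrite [leqLHS]mulnC leq_mul2l /=; apply: (@leq_trans (l.+4 * 2)).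
    by rewrite muln2 -addnn -[l.+4.+1]addn1 leq_add2l.
  by rewrite leq_mul2l.
rewrite uphalfE geq_half_double -mul2n mulnDr muln1 mulnA sumE.
apply: leq_trans (leqnSn _); rewrite [leqRHS]mulnDr [leqRHS]addnC; apply: leq_add.
  by apply: (@leq_trans 4) => //; rewrite leq_pmull // muln_gt0 m_gt0 fact_gt0.
have -> : (m * l`! * (3 * d) = 3 * l`! * (d * m))%N.
  by rewrite mulnCA -[RHS]mulnA (mulnC m l`!) -(mulnA _ m) (mulnC m d).
by rewrite leq_mul2r sum_le orbT.
Qed.

Theorem theorem6p5 (F : fieldType) (g l d m : nat) (f : 'I_l -> ncrat F g)
    (char0 : [pchar F] =i pred0)
    (m_gt0 : (0 < m)%N)
    (deg_f : forall j, exists2 n, sylvester_degree (f j) n & (n <= d)%N)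
    (dom_f : forall j, exists p : 'I_g -> 'M[F]_m, ncrat_dom p (f j))
    (* [uphalf n] is the ceiling of n / 2 *)
    (N := (m * uphalf (m * l`! * (3 * d + 4)))%N)
    (dep_f : forall a : 'I_g -> 'M[F]_N,
       (forall j, ncrat_dom a (f j)) ->
       ~~ free [tuple ncrat_eval a (f j) | j < l]) :
  ncrat_lindep f.
Proof.
have /choice[e eP] : forall j, exists e, f j e /\ exists p : 'I_g -> 'M[F]_m, rdom p e.
  by move=> j; have [p [e fe pe]] := dom_f j; exists e; split; last exists p.
have [p pe] := common_point char0 (fun j => (eP j).2).
have fe j : f j (e j) by case: (eP j).
have deg_e j : pencil_degree_le (e j) d.
  (* The realization of least dimension lives at a point [p'] of unknown size [m'],
     where another representative [e'] may be needed. *)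
  have [n [[m' [p' [c [A [b real]]]]] _] nd] := deg_f j.
  have [_ [e' fe' pe'] _ _] := real.
  have [Q rQ Qn] := realization_degree real fe' pe'.
  have [n1 n2 ee'] := ncrat_equiv char0 (fe j) fe'.
  apply: (pencil_degree_agree char0 n1 n2 n1 (fun s a s_gt0 h1 h2 _ => ee' s a s_gt0 h1 h2)).
  by exists Q; rewrite // (leq_trans Qn).
have [//|ndep] := pselect (ncrat_lindep f).
have independent (c : 'I_l -> F) : (exists j, c j != 0) ->
    exists u, \sum_j c j *: expansion p (e j) u != 0.
  move=> c0; apply: contrapT => /forallNP exp0; apply: ndep; exists c => // e' fe'.
  have nd r j : f j r -> nondegenerate r by move=> fr; case: (ncrat_equiv char0 fr fr).
  have ne' := nondegenerate_lincomb c char0 (fun j => nd _ j (fe' j)).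
  split=> // s a s_gt0 _ ae'.
  have ne := nondegenerate_lincomb c char0 (fun j => nd _ j (fe j)).
  (* [lincomb c e] has a zero expansion about [p], so its degree is [0]; the same
     holds for any other choice of representatives. *)
  have agree : agree_on (lincomb c e') (lincomb c e) (lincomb c e).
    move=> t b t_gt0 be' be _.
    have [_ ->] := lincombP c (rdom_lincomb be').
    have [_ ->] := lincombP c (rdom_lincomb be).
    apply: eq_bigr => j _; congr (_ *: _).
    have [_ _ ee'] := ncrat_equiv char0 (fe' j) (fe j).
    exact: (ee' _ _ t_gt0 (rdom_lincomb be' j) (rdom_lincomb be j)).
  rewrite (pencil_degree0 _ ae'); first exact: raddf0.
  apply: (pencil_degree_agree char0 ne' ne ne agree).
  apply: (expansion0_degree m_gt0 (lincombP c pe).1) => u.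
  by rewrite expansion_lincomb; apply/eqP; apply: contrapT => /negP /exp0.
have := separating_ex pe deg_e independent (leqnn l).
move=> /(separating_pad pe (separating_size l d m_gt0)); rewrite mulnC => -[a [ae asep]].
have N_gt0 : (0 < N)%N.
  by rewrite muln_gt0 m_gt0 (leq_trans _ (separating_size l d m_gt0)).
have evalE j : ncrat_eval a (f j) = rev_at a (e j).
  rewrite /ncrat_eval; case: pselect => [h|[]]; last by exists (e j).
  have [fr ar] := projT2 (cid h); have [_ _] := ncrat_equiv char0 fr (fe j).
  exact.
have := dep_f a (fun j => ex_intro2 _ _ _ (fe j) (ae j)).
case/negP; apply/freeP => c c0; apply: asep => [j|].
  by rewrite leqNgt ltn_ord.
rewrite -[RHS]c0; apply: eq_bigr => j _.
by rewrite -tnth_nth tnth_mktuple evalE.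
Qed.
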